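(* Let $F$ and $F'$ be forests. Then any one of the following three statements implies the other two: 1. The forests $F$ and $F'$ are isomorphic (as graphs). 2. The restricted isotropic matroids $M[IA(F)]$ and $M[IA(F')]$ are isomorphic. 3. The isotropic matroids $M[IAS(F)]$ and $M[IAS(F')]$ are isomorphic.
   Context: Graphs are finite and simple; a forest is a graph with no cycles. For a simple graph $G$ with $n$ vertices, $A(G)$ is its $n\times n$ adjacency matrix with entries in $GF(2)$, and $I$ is the $n\times n$ identity matrix over $GF(2)$. For a matrix $B$ over $GF(2)$, $M[B]$ is the binary matroid represented by $B$: it has one element for each column of $B$ (so equal columns still give distinct elements), and a set of elements is dependent iff the corresponding columns are linearly dependent over $GF(2)$. A matroid isomorphism is a bijection matching dependent sets to dependent sets. The restricted isotropic matroid of $G$ is $M[IA(G)]$, where $IA(G)=\begin{pmatrix} I & A(G)\end{pmatrix}$ is $n\times 2n$. The isotropic matroid of $G$ is $M[IAS(G)]$, where $IAS(G)=\begin{pmatrix} I & A(G) & I+A(G)\end{pmatrix}$ is $n\times 3n$. *)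

(* Defs.v *)
From mathcomp Require Import all_boot all_order all_algebra.

Set Implicit Arguments.
Unset Strict Implicit.
Unset Printing Implicit Defensive.

Import GRing.Theory.
Local Open Scope ring_scope.

Record sgraph := SGraph {
  vertex :> finType;
  adj : rel vertex;
  adj_sym : symmetric adj;
  adj_irrefl : irreflexive adj
}.

(* A [ucycle] of size 2 is just an edge traversed back and forth; the graph
   cycles are exactly the [ucycle]s of size at least 3. *)
Definition is_forest (G : sgraph) : Prop :=
  forall c : seq G, ucycle (@adj G) c -> (size c < 3)%N.

Definition graph_iso (G H : sgraph) : Prop :=
  exists2 f : G -> H, bijective f & forall x y, adj (f x) (f y) = adj x y.

Record matroid := Matroid {
  ground :> finType;
  indep : pred {set ground};
  indep0 : indep set0;
  indepS : forall A B : {set ground}, A \subset B -> indep B -> indep A;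
  indep_augment : forall A B : {set ground}, indep A -> indep B ->
    (#|A| < #|B|)%N -> exists2 x, x \in B :\: A & indep (x |: A)
}.

Definition dependent (M : matroid) (S : {set M}) : bool := ~~ indep S.

Definition matroid_iso (M N : matroid) : Prop :=
  exists2 f : M -> N,
    bijective f & forall S : {set M}, dependent (f @: S) = dependent S.

Section BinaryMatroid.
Variables (m n : nat) (B : 'M['F_2]_(m, n)).

(* [free] is applied to the sequence of columns, one entry per index in [S],
   so a repeated column makes the set dependent. *)
Definition cols_free (S : {set 'I_n}) : bool :=
  free [seq col j B | j <- enum S].

Lemma cols_free0 : cols_free set0.
Proof. by rewrite /cols_free enum_set0 nil_free. Qed.

Lemma cols_freeU1 x (S : {set 'I_n}) : x \notin S ->
  cols_free (x |: S) =
  (col x B \notin <<[seq col j B | j <- enum S]>>%VS) && cols_free S.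
Proof.
move=> xS; rewrite -free_cons; apply: perm_free.
apply: (@perm_map _ _ (fun j => col j B) _ (x :: enum S)).
apply: uniq_perm; rewrite /= ?enum_uniq ?mem_enum ?xS //.
by move=> y; rewrite inE !mem_enum in_setU1.
Qed.

Lemma cols_freeS (S U : {set 'I_n}) :
  S \subset U -> cols_free U -> cols_free S.
Proof.
move=> sSU freeU.
suff: free ([seq col j B | j <- enum S] ++ [seq col j B | j <- enum (U :\: S)]).
  by move/catl_free.
rewrite -map_cat.
suff /(perm_map (fun j => col j B))/perm_free-> :
  perm_eq (enum S ++ enum (U :\: S)) (enum U) by [].
apply: uniq_perm; rewrite ?enum_uniq //.
  rewrite cat_uniq !enum_uniq andbT /=; apply/hasPn => y.
  by rewrite !mem_enum in_setD => /andP[].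
move=> y; rewrite mem_cat !mem_enum in_setD.
by case: (boolP (y \in S)) => //= /(subsetP sSU)->.
Qed.

Lemma cols_free_augment (S U : {set 'I_n}) : cols_free S -> cols_free U ->
  (#|S| < #|U|)%N -> exists2 x, x \in U :\: S & cols_free (x |: S).
Proof.
move=> freeS freeU ltSU; apply/exists_inP; apply: contraLR ltSU.
move=> /exists_inPn noaug; rewrite -leqNgt.
have sz (V : {set 'I_n}) : cols_free V ->
  \dim <<[seq col j B | j <- enum V]>> = #|V|.
  by move/eqnP->; rewrite size_map -cardE.
rewrite -(sz _ freeS) -(sz _ freeU).
apply/dimvS/span_subvP => v /mapP[x].
rewrite mem_enum => xU ->{v}.
have [xS|xS] := boolP (x \in S).
  by apply/memv_span/map_f; rewrite mem_enum.
have := noaug x; rewrite in_setD xS xU => /(_ isT).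
by rewrite cols_freeU1 // freeS andbT negbK.
Qed.

Definition binary_matroid : matroid :=
  Matroid cols_free0 cols_freeS cols_free_augment.

End BinaryMatroid.

Section IsotropicMatroids.
Variable G : sgraph.

Definition adjmx : 'M['F_2]_#|G| :=
  \matrix_(i, j) (adj (enum_val i) (enum_val j))%:R.

Definition IA : 'M['F_2]_(#|G|, #|G| + #|G|) := row_mx 1%:M adjmx.

Definition IAS : 'M['F_2]_(#|G|, #|G| + #|G| + #|G|) :=
  row_mx (row_mx 1%:M adjmx) (1%:M + adjmx).

Definition restricted_isotropic_matroid : matroid := binary_matroid IA.

Definition isotropic_matroid : matroid := binary_matroid IAS.

End IsotropicMatroids.

(* Main.v *)
Require Import Defs.
From Corelib Require Import Setoid.
From mathcomp Require Import all_boot all_order all_fingroup all_algebra.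

(** A binary matroid is handled through the row space of its matrix, a set of
    functions from the ground set to GF(2); since the zero-sum sets of columns are
    the disjoint unions of circuits, a matroid isomorphism transports it.  In both
    cases two forests present one and the same row space, and we induct on the
    number of edges: a leaf [x] attached to [w] makes two elements parallel, this
    parallel pair is located in the second presentation, transpositions of the
    ground set that preserve the row space make the two presentations agree near
    it, and the edge [xw] is then cut in both.  Elements used by earlier cuts are
    kept fixed, so that the isomorphism of the smaller forests extends.

    For [IA(F)] this gives an isomorphism of the bipartite double covers of [F] and
    [F'], each of which is two copies of the forest.  The two sheet exchanges act
    as fixed-point free involutions on the components of one common graph; choosing
    a set of components that meets each orbit of both involutions exactly once
    yields [F] isomorphic to [F'].  For [IAS(F)] the triple [phi, chi, psi] of a
    vertex has to be recovered as well, from lines through the parallel class of a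
    leaf; the only ambiguity comes from components that are an edge or a path on
    four vertices, where extra automorphisms of the matroid repair it. *)

Set Implicit Arguments.
Unset Strict Implicit.
Unset Printing Implicit Defensive.

Import GRing.Theory.

(** * One-degenerate graphs *)

Notation "\xor_ ( i | P ) F" := (\big[addb/false]_(i | P) F)
  (at level 41, F at level 41, i at level 50).

Section OneDegenerate.
Variables (V : finType) (e : rel V).
Hypotheses (esym : symmetric e) (eirr : irreflexive e).

(** Acyclicity is used only in this form: it passes to subgraphs at once, and a suitable [S]
    excludes a short cycle or produces a leaf. *)
Definition one_degenerate := forall S : {set V}, S != set0 ->
  exists2 x, x \in S &
    forall y z, y \in S -> z \in S -> e x y -> e x z -> y = z.

Definition is_leaf x w := forall y, e x y = (y == w).

(** The path grows at its head [x]: a neighbour of [x] in [S] other than the second vertex is either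
    new or closes a cycle. *)
Lemma uniq_path_extend (S : {set V}) n :
  (forall c, ucycle e c -> size c < 3) -> S != set0 ->
  (forall x, x \in S -> exists y z,
     [/\ y \in S, z \in S, e x y, e x z & y != z]) ->
  exists x p, [/\ size p = n, path e x p, uniq (x :: p) & all [in S] (x :: p)].
Proof.
move=> acyc /set0Pn[x0 x0S] deg2; elim: n => [|n [x [p [szp pth unq inS]]]].
  by exists x0, [::]; rewrite /= x0S.
have xS : x \in S by case/andP: inS.
have [y [z [yS zS exy exz yz]]] := deg2 x xS.
have [u [uS exu uhead]] : exists u, [/\ u \in S, e x u & u != head x p].
  have [yh|yh] := eqVneq y (head x p); last by exists y.
  by exists z; split=> //; rewrite -yh eq_sym.
have ux : u != x by apply: contraTneq exu => ->; rewrite eirr.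
have [up|up] := boolP (u \in p); last first.
  exists u, (x :: p); split=> //=; first by rewrite szp.
  - by rewrite esym exu.
  - by rewrite inE negb_or ux up.
  - by rewrite uS.
exfalso; case/splitPr: up => p1 p2 in szp pth unq inS uhead *.
(* This cycle has length at least three: [u] is not the second vertex of the path, so [p1] is
   nonempty. *)
suff /acyc : ucycle e (x :: rcons p1 u).
  by rewrite /= size_rcons; case: p1 uhead {szp pth unq inS} => //=; rewrite eqxx.
move: unq pth; rewrite -cat_rcons -cat_cons cat_uniq cat_path => /and3P[unq _ _].
move=> /andP[pth _]; apply/andP; split=> //.
by rewrite /path.cycle rcons_path pth last_rcons esym.
Qed.

(** Otherwise every vertex of [S] has two neighbours in [S] and repetition-free paths of any length
    exist; one with [#|V|] edges already has too many vertices. *)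
Lemma acyclic_one_degenerate :
  (forall c, ucycle e c -> size c < 3) -> one_degenerate.
Proof.
move=> acyc S S0.
have [/existsP[x /andP[xS /'forall_implyP uniqx]]|/existsPn noleaf] := boolP
  [exists x, (x \in S) && [forall p, [&& p.1 \in S, p.2 \in S, e x p.1 & e x p.2]
    ==> (p.1 == p.2)]].
  exists x => // y z yS zS exy exz.
  by apply/eqP; apply: (uniqx (y, z)); rewrite /= yS zS exy.
exfalso; have deg2 x : x \in S -> exists y z,
    [/\ y \in S, z \in S, e x y, e x z & y != z].
  move=> xS; have := noleaf x; rewrite xS => /forallPn[[y z]].
  by rewrite negb_imply /= => /andP[/and4P[]]; exists y, z.
have [x [p [szp _ unq _]]] := uniq_path_extend #|V| acyc S0 deg2.
by have := max_card (mem (x :: p)); rewrite (card_uniqP unq) /= szp ltnn.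
Qed.

Hypothesis deg1 : one_degenerate.

Lemma one_degenerate_sub (e' : rel V) : subrel e' e ->
  forall S : {set V}, S != set0 -> exists2 x, x \in S &
    forall y z, y \in S -> z \in S -> e' x y -> e' x z -> y = z.
Proof.
move=> sub S /deg1[x xS uniqx]; exists x => // y z yS zS /sub exy /sub exz.
exact: uniqx.
Qed.

Lemma one_degenerate_triangle x y z : e x y -> e y z -> e x z -> False.
Proof.
move=> exy eyz exz.
have xy : x != y by apply/eqP => E; move: exy; rewrite E eirr.
have yz : y != z by apply/eqP => E; move: eyz; rewrite E eirr.
have xz : x != z by apply/eqP => E; move: exz; rewrite E eirr.
have [|u] := deg1 (S := [set x; y; z]).
  by apply/set0Pn; exists x; rewrite !inE eqxx.
rewrite !inE -!orbA => /or3P[] /eqP-> uniqu.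
- by case/eqP: yz; apply: uniqu; rewrite ?inE ?eqxx ?orbT.
- by case/eqP: xz; apply: uniqu; rewrite ?inE ?eqxx ?orbT // esym.
- by case/eqP: xy; apply: uniqu; rewrite ?inE ?eqxx ?orbT // esym.
Qed.

(** If [u] and [v] differed, each of the four vertices would have two distinct neighbours among
    them. *)
Lemma one_degenerate_square x y u v :
  e x u -> e x v -> e y u -> e y v -> x != y -> u = v.
Proof.
move=> exu exv eyu eyv xy; apply/eqP; apply: contraT => uv.
have [|z] := deg1 (S := [set x; y; u; v]).
  by apply/set0Pn; exists x; rewrite !inE eqxx.
rewrite !inE -!orbA => /or4P[] /eqP-> uniqz.
- by case/eqP: uv; apply: uniqz; rewrite ?inE ?eqxx ?orbT.
- by case/eqP: uv; apply: uniqz; rewrite ?inE ?eqxx ?orbT.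
- by case/eqP: xy; apply: uniqz; rewrite ?inE ?eqxx ?orbT // esym.
- by case/eqP: xy; apply: uniqz; rewrite ?inE ?eqxx ?orbT // esym.
Qed.

(** The set of non-isolated vertices contains all neighbours of its members, so having at most one
    neighbour in it means being a leaf. *)
Lemma one_degenerate_leaf a b : e a b -> exists x w, is_leaf x w.
Proof.
move=> eab; have [|x] := deg1 (S := [set x | [exists y, e x y]]).
  by apply/set0Pn; exists a; rewrite inE; apply/existsP; exists b.
rewrite inE => /existsP[w exw] uniqx; exists x, w => y.
apply/idP/eqP => [exy|-> //]; apply: uniqx => //; rewrite inE; apply/existsP.
  by exists x; rewrite esym.
by exists x; rewrite esym.
Qed.

(** Take out a vertex with at most one neighbour in [S], colour the rest, and give the vertex the
    colour its neighbour does not have. *)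
Lemma one_degenerate_colouring :
  exists col : V -> bool, forall x y, e x y -> col x != col y.
Proof.
suff colS n : forall S : {set V}, #|S| = n -> exists col : V -> bool,
    forall x y, x \in S -> y \in S -> e x y -> col x != col y.
  have [col colP] := colS _ setT erefl.
  by exists col => x y; apply: colP; rewrite inE.
elim: n => [|n IHn] S cardS.
  by exists xpredT => x y; rewrite (cards0_eq cardS) inE.
have [|x xS uniqx] := deg1 (S := S); first by rewrite -card_gt0 cardS.
have [|col colP] := IHn (S :\ x).
  by move: cardS; rewrite (cardsD1 x) xS => -[].
pose cx := if [pick y in S | e x y] is Some y then ~~ col y else true.
have cxP y : y \in S -> e x y -> cx != col y.
  rewrite /cx; case: pickP => [z /andP[zS exz]|none] yS exy; last first.
    by have := none y; rewrite /= yS exy.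
  by rewrite (uniqx y z) //; case: (col z).
exists (fun y => if y == x then cx else col y) => y z yS zS eyz.
have [yx|yx] := eqVneq y x; have [zx|zx] := eqVneq z x.
- by rewrite yx zx eirr in eyz.
- by apply: cxP; rewrite -?yx.
- by rewrite eq_sym cxP // esym -zx.
- by apply: colP; rewrite ?inE ?yx ?zx.
Qed.

Lemma leaf_irr x w : is_leaf x w -> x != w.
Proof. by move=> lf; apply/eqP => xw; move: (lf w); rewrite -xw eirr eqxx. Qed.

Lemma xor_pred1 (P : pred V) a : \xor_(x | P x) (x == a) = P a.
Proof.
have [Pa|Pa] := boolP (P a).
  rewrite (bigD1 a) //= eqxx big1 // => x /andP[_ /negbTE]; exact.
rewrite big1 // => x Px; apply/negbTE; apply: contraNneq Pa => <-; exact: Px.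
Qed.

Lemma xor_leaf x w (f : V -> bool) : is_leaf x w -> \xor_(u | e x u) f u = f w.
Proof. by move=> lf; rewrite (big_pred1 w) // => u; rewrite lf. Qed.

(* A leaf is not deleted but isolated, so that the vertex type stays the same
   along the induction. *)
Definition cut x w : rel V :=
  fun a b => e a b && ~~ ((a == x) && (b == w) || (a == w) && (b == x)).

Lemma cut_sym x w : symmetric (cut x w).
Proof.
move=> a b; rewrite /cut esym; congr (_ && ~~ _).
by rewrite orbC; congr (_ || _); rewrite andbC.
Qed.

Lemma cut_sub x w : subrel (cut x w) e. Proof. by move=> a b /andP[]. Qed.

Lemma cut_irr x w : irreflexive (cut x w).
Proof. by move=> a; rewrite /cut eirr. Qed.

Lemma cut_leafE x w a b : is_leaf x w ->
  cut x w a b = [&& e a b, a != x & b != x].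
Proof.
move=> lf; rewrite /cut; case: eqVneq => [->|ax] /=.
  by rewrite lf; case: eqVneq => //=; rewrite andbF.
case: (eqVneq b x) => [->|bx]; last by rewrite andbF.
by rewrite esym lf; case: eqVneq => //; rewrite andbF.
Qed.

Lemma card_cut x w : e x w ->
  #|[set p : V * V | cut x w p.1 p.2]| < #|[set p : V * V | e p.1 p.2]|.
Proof.
move=> exw; apply: proper_card; apply/properP; split.
  by apply/subsetP => p; rewrite !inE => /cut_sub.
exists (x, w); rewrite !inE //=.
by rewrite /cut !eqxx andbF.
Qed.

Lemma xor_cut_leaf x w (f : V -> bool) : is_leaf x w ->
  \xor_(u | cut x w x u) f u = false.
Proof. by move=> lf; rewrite big1 // => u; rewrite cut_leafE // eqxx andbF. Qed.

Lemma xor_cut_hub x w (f : V -> bool) : is_leaf x w ->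
  \xor_(u | e w u) f u = f x (+) \xor_(u | cut x w w u) f u.
Proof.
move=> lf; rewrite (bigD1 x) /=; last by rewrite esym lf.
congr (_ (+) _); apply: eq_bigl => u; rewrite cut_leafE //.
by rewrite (eq_sym w x) (leaf_irr lf).
Qed.

Lemma xor_cut_other x w v (f : V -> bool) : is_leaf x w -> v != x -> v != w ->
  \xor_(u | cut x w v u) f u = \xor_(u | e v u) f u.
Proof.
move=> lf vx vw; apply: eq_bigl => u; rewrite cut_leafE // vx /=.
case: (eqVneq u x) => [->|]; last by rewrite andbT.
by rewrite esym lf (negbTE vw).
Qed.

End OneDegenerate.

(** * Bases of a binary matroid whose fundamental graph is a forest *)

Section FundamentalGraph.
Variable E : finType.
Implicit Types (B C : {set E}) (e : rel E) (f g : E -> bool).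

(* The equation at [y] says that [f] sums to zero on the fundamental circuit of
   [y] with respect to the basis [B]. *)
Definition row_space B e f := forall y, y \notin B -> f y = \xor_(x | e y x) f x.

Definition fundamental_graph B e :=
  [/\ symmetric e, irreflexive e, one_degenerate e
    & forall x y, e x y -> (x \in B) != (y \in B)].

(** The indicator of the fundamental cocircuit of [x0]; for [x0] outside [B] it vanishes as soon as
    all edges cross [B]. *)
Definition basis_row B e x0 y := if y \in B then y == x0 else e y x0.

Lemma basis_rowP B e x0 : (forall x y, e x y -> (x \in B) != (y \in B)) ->
  row_space B e (basis_row B e x0).
Proof.
move=> bip y yB; rewrite {1}/basis_row (negbTE yB) -xor_pred1.
apply: eq_bigr => x /bip; rewrite (negbTE yB) /basis_row.
by case: (x \in B).
Qed.

Lemma eq_row_space B e f g : f =1 g -> row_space B e f -> row_space B e g.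
Proof.
move=> fg rf y yB; rewrite -fg rf //; apply: eq_bigr => x _; exact: fg.
Qed.

(** This is matroid duality: the complementary basis with the same graph presents the orthogonal
    complement. The sums over [B] and over its complement both run over the edges with equal terms;
    conversely, it suffices to test [g] against basis rows. *)
Lemma row_space_dual B e g : fundamental_graph B e ->
  (row_space (~: B) e g <->
   forall f, row_space B e f -> \xor_(y | predT y) (f y && g y) = false).
Proof.
case=> esym eirr _ bip; split=> [rg f rf|orth x xB].
  rewrite (bigID [in B]) /=.
  rewrite (eq_bigr (fun x => \xor_(y | e x y) (f x && g y))); last first.
    by move=> x xB; rewrite -big_distrr ?rg ?inE ?xB.
  rewrite (eq_bigr (fun y => \xor_(x | e y x) (f x && g y))
    (P := fun y => y \notin B)); last by move=> y yB; rewrite -big_distrl rf.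
  rewrite (exchange_big_dep [predC B]) /=; last first.
    by move=> x y xB /bip; rewrite xB; case: (y \in B).
  rewrite -big_split /= big1 // => y yB.
  rewrite (eq_bigl (fun x => e y x)) ?addbb // => x.
  by rewrite esym; case: (boolP (e y x)) => [/bip|]; rewrite ?andbF ?andbT //
    (negbTE yB); case: (x \in B).
rewrite inE negbK in xB.
have := orth _ (basis_rowP x bip).
rewrite (bigD1 x) //= {1}/basis_row xB eqxx /= => /(canRL (addbK _)) /= ->.
rewrite big_mkcond [RHS]big_mkcond; apply: eq_bigr => y _ /=.
rewrite /basis_row; have [->|yx] := eqVneq y x; first by rewrite eirr.
rewrite /=; case: ifPn => yB; last by rewrite (esym y); case: (e x y).
by case: (boolP (e x y)) => // /bip; rewrite xB yB.
Qed.

End FundamentalGraph.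

(** * Two forest presentations of the same row space *)

Section SamePresentations.
Variable E : finType.
Implicit Types (B C : {set E}) (e : rel E) (f g : E -> bool).

Lemma fundamental_graph_cut B e x w : is_leaf e x w ->
  fundamental_graph B e -> fundamental_graph B (cut e x w).
Proof.
move=> lf [esym eirr deg1 bip]; split.
- exact: cut_sym.
- exact: cut_irr.
- exact: one_degenerate_sub deg1 _ (@cut_sub _ _ _ _).
- by move=> a b /cut_sub/bip.
Qed.

(** Before the cut [x] is parallel to [w], after it [x] is a loop. The right-hand side mentions [e]
    only through its row space, so equal row spaces stay equal when the same edge is cut in both
    presentations. *)
Lemma row_space_cut B e x w f : fundamental_graph B e -> is_leaf e x w ->
  x \notin B ->
  row_space B (cut e x w) f <->
  ~~ f x /\ row_space B e (fun y => if y == x then f w else f y).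
Proof.
move=> [esym eirr _ bip] lf xB.
have wB : w \in B.
  by have := bip x w; rewrite lf eqxx (negbTE xB) => /(_ isT); case: (w \in B).
have sumE y : y \notin B -> y != x ->
    \xor_(u | cut e x w y u) f u =
    \xor_(u | e y u) (if u == x then f w else f u).
  move=> yB yx; have yw : y != w by apply: contraNneq yB => ->.
  rewrite (xor_cut_other esym _ lf yx yw); apply: eq_bigr => u eyu.
  by case: eqP => // ux; move: eyu; rewrite ux esym lf (negbTE yw).
split=> [rf|[fx rf] y yB].
  split; first by rewrite rf // (xor_cut_leaf esym _ lf).
  move=> y yB; case: eqVneq => [->|yx]; last by rewrite rf // sumE.
  by rewrite (xor_leaf _ lf) eq_sym (negbTE (leaf_irr eirr lf)).
have [->|yx] := eqVneq y x.
  by rewrite (xor_cut_leaf esym _ lf) (negbTE fx).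
by rewrite sumE // -rf // (negbTE yx).
Qed.

Definition same_rows B1 e1 B2 e2 :=
  forall f, row_space B1 e1 f <-> row_space B2 e2 f.

Lemma same_rows_dual B1 e1 B2 e2 :
  fundamental_graph B1 e1 -> fundamental_graph B2 e2 ->
  same_rows B1 e1 B2 e2 -> same_rows (~: B1) e1 (~: B2) e2.
Proof.
move=> fg1 fg2 same g; rewrite !row_space_dual //.
by split=> orth f /same/orth.
Qed.

Lemma fundamental_graph_dual B e :
  fundamental_graph B e -> fundamental_graph (~: B) e.
Proof.
case=> esym eirr deg1 bip; split=> // x y /bip; rewrite !inE.
by case: (x \in B); case: (y \in B).
Qed.

(** Fixing [C] pointwise lets an isomorphism of the cut graphs be extended over the removed edge,
    whose ends are put into [C]. *)
Definition extends_to_iso C e1 e2 := exists2 g : E -> E, injective g &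
  (forall a, a \in C -> g a = a) /\ forall a b, e2 (g a) (g b) = e1 a b.

(** The leaf makes [x] parallel to [w], a property of the row space alone; another element parallel
    to a basis element [w] is outside the basis and has [w] as its only neighbour. *)
Lemma same_leaf B1 e1 B2 e2 x w :
  fundamental_graph B1 e1 -> fundamental_graph B2 e2 ->
  same_rows B1 e1 B2 e2 -> is_leaf e1 x w -> x \notin B1 -> w \in B2 ->
  x \notin B2 /\ is_leaf e2 x w.
Proof.
move=> [_ eirr1 _ bip1] [_ eirr2 _ bip2] same lf xB1 wB2.
have parallel v : basis_row B2 e2 v x = basis_row B2 e2 v w.
  by have /same -> // := basis_rowP v bip2; rewrite (xor_leaf _ lf).
have xw := leaf_irr eirr1 lf.
have xB2 : x \notin B2.
  apply/negP => xB2; have := parallel w.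
  by rewrite /basis_row xB2 wB2 eqxx (negbTE xw).
split=> // v; have := parallel v; rewrite /basis_row (negbTE xB2) wB2 => ->.
exact: eq_sym.
Qed.

Section Step.
Variable n : nat.
Hypothesis IHn : forall B1 e1 B2 e2 C,
  #|[set p : E * E | e1 p.1 p.2]| < n ->
  fundamental_graph B1 e1 -> fundamental_graph B2 e2 ->
  same_rows B1 e1 B2 e2 -> {in C, B1 =i B2} -> extends_to_iso C e1 e2.

Lemma iso_step_common B1 e1 B2 e2 C x w :
  #|[set p : E * E | e1 p.1 p.2]| <= n ->
  fundamental_graph B1 e1 -> fundamental_graph B2 e2 ->
  same_rows B1 e1 B2 e2 -> {in C, B1 =i B2} ->
  is_leaf e1 x w -> x \notin B1 -> w \in B2 -> extends_to_iso C e1 e2.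
Proof.
move=> le_n fg1 fg2 same BC lf xB1 wB2.
have [xB2 lf2] := same_leaf fg1 fg2 same lf xB1 wB2.
have e1xw : e1 x w by rewrite lf.
have wB1 : w \in B1.
  by case: fg1 => _ _ _ /(_ _ _ e1xw); rewrite (negbTE xB1); case: (w \in B1).
have [|||||g ginj [gC gE]] :=
  IHn (B1 := B1) (e1 := cut e1 x w) (B2 := B2) (e2 := cut e2 x w)
      (C := x |: (w |: C)).
- by apply: leq_trans le_n; apply: card_cut.
- exact: fundamental_graph_cut.
- exact: fundamental_graph_cut.
- move=> f; rewrite !row_space_cut //.
  by split=> -[fx rf]; split=> //; apply/same.
- move=> y; rewrite !inE => /or3P[/eqP->|/eqP->|/BC //].
    by rewrite (negbTE xB1) (negbTE xB2).
  by rewrite wB1 wB2.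
exists g => //; split=> [a aC|a b]; first by rewrite gC // !inE aC !orbT.
have gx : g x = x by rewrite gC // !inE eqxx.
have gw : g w = w by rewrite gC // !inE eqxx orbT.
have gx' y : (g y == x) = (y == x) by rewrite -{1}gx (inj_eq ginj).
have gw' y : (g y == w) = (y == w) by rewrite -{1}gw (inj_eq ginj).
have [sym1 _ _ _] := fg1; have [sym2 _ _ _] := fg2.
have [->|ax] := eqVneq a x; first by rewrite gx lf2 lf gw'.
have [->|bx] := eqVneq b x; first by rewrite gx sym2 sym1 lf2 lf gw'.
have := gE a b; rewrite (cut_leafE sym1 _ _ lf) (cut_leafE sym2 _ _ lf2).
by rewrite !gx' ax bx !andbT.
Qed.

(** If [w] is not in [B2], some [u] in [B2] is parallel to [w]. Transposing [u] and [w] preserves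
    the row space and leads back to the case where [w] is in [B2]. *)
Lemma iso_step B1 e1 B2 e2 C x w :
  #|[set p : E * E | e1 p.1 p.2]| <= n ->
  fundamental_graph B1 e1 -> fundamental_graph B2 e2 ->
  same_rows B1 e1 B2 e2 -> {in C, B1 =i B2} ->
  is_leaf e1 x w -> x \notin B1 -> extends_to_iso C e1 e2.
Proof.
move=> le_n fg1 fg2 same BC lf xB1.
have [wB2|wB2] := boolP (w \in B2); first exact: iso_step_common lf xB1 wB2.
have e1xw : e1 x w by rewrite lf.
have [sym1 irr1 _ bip1] := fg1; have [sym2 irr2 deg2 bip2] := fg2.
have wB1 : w \in B1.
  by have := bip1 _ _ e1xw; rewrite (negbTE xB1); case: (w \in B1).
have xw := leaf_irr irr1 lf.
have parallel f : row_space B2 e2 f -> f x = f w.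
  by move=> /same -> //; rewrite (xor_leaf _ lf).
have [u uB2 upar] : exists2 u, u \in B2 &
    forall f, row_space B2 e2 f -> f u = f w.
  have [xB2|xB2] := boolP (x \in B2); first by exists x.
  (* Being parallel, [x] and [w] have the same neighbours: at most one, as there are no squares, and
     at least one, as [w] lies in [B1] and so is not a loop. *)
  have nbr v : v \in B2 -> e2 x v = e2 w v.
    move=> vB2; have := parallel _ (basis_rowP v bip2).
    by rewrite /basis_row (negbTE xB2) (negbTE wB2).
  have : basis_row B1 e1 w w by rewrite /basis_row wB1 eqxx.
  have /same r := basis_rowP w bip1.
  have [/existsP[u e2wu] _|/existsPn none] := boolP [exists u, e2 w u]; last first.
    by rewrite (r w) // big1 // => u; rewrite (negbTE (none u)).
  have uB2 : u \in B2.
    by have := bip2 _ _ e2wu; rewrite (negbTE wB2); case: (u \in B2).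
  exists u => // f rf; rewrite (rf w) // (big_pred1 u) // => v.
  apply/idP/eqP => [e2wv|-> //].
  have vB2 : v \in B2.
    by have := bip2 _ _ e2wv; rewrite (negbTE wB2); case: (v \in B2).
  apply: (one_degenerate_square sym2 deg2 _ _ e2wv e2wu xw); by rewrite nbr.
have uw : u != w by apply: contraNneq wB2 => <-.
have uB1 : u \notin B1.
  apply/negP => uB1; have /same/upar := basis_rowP w bip1.
  by rewrite /basis_row uB1 wB1 eqxx (negbTE uw).
pose t := tperm u w.
have tK : involutive t by move=> y; rewrite /t tpermK.
have rt f : row_space B2 e2 f -> f \o t =1 f.
  move=> rf y; rewrite /= /t; case: tpermP => [->|->|//]; rewrite upar //.
pose B2' := [set y | t y \in B2]; pose e2' := [rel a b | e2 (t a) (t b)].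
have sumt f y : \xor_(v | e2' y v) f v = \xor_(v | e2 (t y) v) f (t v).
  rewrite (reindex_inj (inv_inj tK)) /=.
  by apply: eq_bigl => v; rewrite /= tK.
have rowt f : row_space B2' e2' f <-> row_space B2 e2 (f \o t).
  split=> rf y yB; first by have := rf (t y); rewrite inE sumt tK /=; apply.
  by rewrite sumt; have := rf (t y); rewrite /= tK; apply; move: yB; rewrite inE.
have [||||g ginj [gC gE]] :=
  iso_step_common (B1 := B1) (e1 := e1) (B2 := B2') (e2 := e2') (C := C)
    le_n fg1 _ _ _ lf xB1 _.
- split=> [a b|a|S|a b]; rewrite /= ?inE; [exact: sym2|exact: irr2| |exact: bip2].
  move=> S0; have [|y] := deg2 (t @: S).
    by rewrite -card_gt0 card_imset ?card_gt0 //; apply: inv_inj.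
  case/imsetP=> z zS -> uniqz; exists z => // a b aS bS /uniqz ua /ua ub.
  by apply: (inv_inj tK); apply: ub; apply: imset_f.
- move=> f; rewrite rowt same; split=> rf.
    by apply: eq_row_space (rf) => y; rewrite -(rt _ rf).
  by apply: eq_row_space (rf) => y; rewrite -(rt _ rf) /= tK.
- move=> y yC; rewrite inE /t; case: tpermP => [yu|yw|_ _]; last exact: BC.
    by move: (BC _ yC); rewrite yu uB2 (negbTE uB1).
  by move: (BC _ yC); rewrite yw wB1 (negbTE wB2).
- by rewrite inE /t tpermR.
exists (t \o g); first exact: inj_comp (inv_inj tK) ginj.
split=> [a aC|a b]; last by rewrite -gE.
(* Each of [u] and [w] belongs to exactly one of the two bases, hence neither is in [C]. *)
rewrite /= gC // /t tpermD //; apply/eqP => E0; move: (BC _ aC); rewrite -E0.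
  by rewrite uB2 (negbTE uB1).
by rewrite wB1 (negbTE wB2).
Qed.

End Step.

(** Induction on the number of edges. A leaf inside [B1] becomes a leaf outside the basis after
    passing to the duals. *)
Theorem fundamental_graph_unique B1 e1 B2 e2 C :
  fundamental_graph B1 e1 -> fundamental_graph B2 e2 ->
  same_rows B1 e1 B2 e2 -> {in C, B1 =i B2} -> extends_to_iso C e1 e2.
Proof.
move: {2}_.+1 (ltnSn #|[set p : E * E | e1 p.1 p.2]|) => n.
elim: n => [//|n IHn] in B1 e1 B2 e2 C *; rewrite ltnS => le_n fg1 fg2 same BC.
have [sym1 irr1 deg1 bip1] := fg1; have [sym2 irr2 deg2 bip2] := fg2.
have [/existsP[a /existsP[b eab]]|/existsPn none1] :=
    boolP [exists a, exists b, e1 a b].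
  have [x [w lf]] := one_degenerate_leaf sym1 deg1 eab.
  have [xB1|xB1] := boolP (x \in B1); last first.
    exact: (iso_step IHn le_n fg1 fg2 same BC lf).
  apply: (iso_step IHn le_n (fundamental_graph_dual fg1)
    (fundamental_graph_dual fg2) (same_rows_dual fg1 fg2 same) _ lf).
    by move=> y yC; rewrite !inE BC.
  by rewrite inE negbK.
have e1F a b : e1 a b = false by have /existsPn/(_ b)/negbTE := none1 a.
suff e2F a b : e2 a b = false by exists id => //; split=> // a b; rewrite e1F e2F.
apply/negP => e2ab.
wlog aB2 : a b e2ab / a \in B2.
  move=> hwlog; have [|aB2] := boolP (a \in B2); first exact: hwlog e2ab.
  apply: (hwlog b a); first by rewrite sym2.
  by have := bip2 _ _ e2ab; rewrite (negbTE aB2); case: (b \in B2).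
have bB2 : b \notin B2 by have := bip2 _ _ e2ab; rewrite aB2; case: (b \in B2).
(* Without edges every function supported on [B1] is a row. The second presentation's row of [a]
   forces [b] into [B1], and then the indicator of [b] is a row violating the second presentation's
   equation at [b]. *)
have row1 f : (forall y, y \notin B1 -> f y = false) -> row_space B1 e1 f.
  by move=> f0 y yB1; rewrite f0 // big1 // => v; rewrite e1F.
have bB1 : b \in B1.
  apply: contraT => bB1; have /same/(_ b bB1) := basis_rowP a bip2.
  rewrite /basis_row (negbTE bB2) sym2 e2ab => /esym.
  by rewrite big1 // => v; rewrite e1F.
have /row1/same/(_ b bB2) : forall y, y \notin B1 -> (y == b) = false.
  by move=> y; apply: contraNF => /eqP->.
rewrite eqxx big1 // => v ebv; apply/eqP => vb.
by move: ebv; rewrite vb irr2.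
Qed.

End SamePresentations.

(** * Cancelling the bipartite double cover *)

Section FlipColouring.
Variables (H : finType) (e : rel H) (s1 s2 : H -> H).
Hypotheses (esymm : symmetric e) (s1K : involutive s1) (s2K : involutive s2).
Hypotheses (s1e : forall a b, e (s1 a) (s1 b) = e a b).
Hypotheses (s2e : forall a b, e (s2 a) (s2 b) = e a b).
Hypotheses (s1free : forall h, ~~ connect e h (s1 h)).
Hypotheses (s2free : forall h, ~~ connect e h (s2 h)).

Let rho h := s1 (s2 h).

Lemma connect_homo (T T' : finType) (r : rel T) (r' : rel T') (f : T -> T') :
  (forall a b, r a b -> r' (f a) (f b)) ->
  forall a b, connect r a b -> connect r' (f a) (f b).
Proof.
move=> fr a b /connectP[p pth ->]; apply/connectP; exists (map f p).
  exact: homo_path pth.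
by rewrite last_map.
Qed.

Lemma s1_connect a b : connect e a b -> connect e (s1 a) (s1 b).
Proof. by apply: connect_homo => {}a {}b; rewrite s1e. Qed.

Lemma s2_connect a b : connect e a b -> connect e (s2 a) (s2 b).
Proof. by apply: connect_homo => {}a {}b; rewrite s2e. Qed.

Lemma rho_connect n a b :
  connect e a b -> connect e (iter n rho a) (iter n rho b).
Proof.
elim: n => // n IHn /IHn/s2_connect/s1_connect; exact.
Qed.

(** Applying [s1] and then [s2] to both ends turns the claim for [n] at [h] into the one for [n - 2]
    at [rho h]. The cases 0 and 1 are the freeness of [s1] and of [s2]. *)
Lemma flip_not_connected n h : ~~ connect e (iter n rho h) (s1 h).
Proof.
elim: n {-2}n (leqnn n) h => [|m IHm] n; first by case: n => // _ h.
case: n => [|[|n]]; first by move=> _ h; apply: s1free.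
  move=> _ h; apply: contraNN (s2free h) => /s1_connect.
  by rewrite /= /rho !s1K sym_connect_sym.
move=> le_nm h; apply: contraNN (IHm n (ltnW le_nm) (rho h)) => /s1_connect/s2_connect.
have rhoK x : s2 (s1 (rho x)) = x by rewrite /rho s1K s2K.
by rewrite iterS rhoK -iterSr s1K {2}/rho s1K.
Qed.

(** Its components are the orbits of [rho] on the components of [e]; on them [s1] and [s2] act
    alike. *)
Definition merged : rel H := [rel a b | [|| e a b, b == rho a | a == rho b]].

Lemma merged_sym : connect_sym merged.
Proof.
by apply: sym_connect_sym => a b; rewrite /merged /= (esymm a b) (orbC (b == _)).
Qed.

(** Powers of [rho] are allowed at both ends, so a step along [rho] in either direction is absorbed
    without its inverse. *)
Lemma merged_connect a b : connect merged a b ->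
  exists k l, connect e (iter k rho a) (iter l rho b).
Proof.
case/connectP=> p; elim: p a => [|c p IHp] a /=; first by move=> _ ->; exists 0, 0.
case/andP=> ac /IHp{}IHp /IHp[k [l kl]]; case/or3P: ac => [eac|/eqP cE|/eqP aE].
- by exists k, l; apply: connect_trans kl; apply/rho_connect/connect1.
- by exists k.+1, l; rewrite iterSr -cE.
- exists k, l.+1; rewrite aE -iterSr /=; exact: s1_connect (s2_connect kl).
Qed.

(** Since [s1] conjugates [rho] into its inverse, a connection would join some [iter n rho h0] to
    [s1 h0] in [e]. *)
Lemma merged_flip h : ~~ connect merged h (s1 h).
Proof.
apply/negP => /merged_connect[k [l]].
have unwind m a : iter m rho (s1 (iter m rho a)) = s1 a.
  elim: m => // m IHm in a *; rewrite -[in RHS](s1K a).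
  by rewrite iterSr iterS [rho (s1 _)]/rho /rho s1K s2K IHm s1K.
have [h0 ->] : exists h0, h = iter l rho h0.
  elim: l => [|l [h0 ->]]; first by exists h.
  by exists (s2 (s1 h0)); rewrite iterSr /rho s2K s1K.
by rewrite unwind -iterD (negbTE (flip_not_connected _ _)).
Qed.

(* The involutions act freely on the components, so the graph on components
   formed by their two perfect matchings is a union of even cycles and is
   properly 2-coloured. *)
Lemma flip_colouring : exists k : H -> bool,
  [/\ forall a b, e a b -> k a = k b, forall a, k (s1 a) = ~~ k a
    & forall a, k (s2 a) = ~~ k a].
Proof.
(* Both involutions exchange the same two merged components; comparing their ranks chooses one of
   the two. *)
pose rk h := enum_rank (fingraph.root merged h).
have rkE a b : connect merged a b -> rk a = rk b.
  by move=> /(fingraph.rootP merged_sym) ab; rewrite /rk ab.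
have rk1 a : rk a != rk (s1 a).
  apply: contraNneq (merged_flip a) => /enum_rank_inj.
  by move/(fingraph.rootP merged_sym).
have rkrho a : rk (rho a) = rk a.
  by apply/esym/rkE/connect1; rewrite /merged /= eqxx orbT.
have rk2 a : rk (s2 a) = rk (s1 a).
  by rewrite -(rkrho (s2 a)) /rho s2K.
have k1 a : (rk (s1 a) < rk (s1 (s1 a))) = ~~ (rk a < rk (s1 a)).
  by rewrite s1K -leqNgt [RHS]leq_eqVlt (inj_eq (@ord_inj _)) eq_sym (negbTE (rk1 a)).
exists (fun h => rk h < rk (s1 h)); split=> // a => [b eab|].
  by rewrite (rkE a b) 1?(rkE (s1 a) (s1 b)) //; apply: connect1;
    rewrite /merged /= ?s1e eab.
by rewrite -k1 s1K rk2 -[in s1 (s2 a)]/(rho a) rkrho.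
Qed.

End FlipColouring.

Section DoubleCover.

Definition double_cover (V : finType) (e : rel V) : rel (V * bool) :=
  [rel p q | (p.2 != q.2) && e p.1 q.1].

Definition sheet_swap (V : finType) (p : V * bool) := (p.1, ~~ p.2).

Lemma sheet_swapK (V : finType) : involutive (@sheet_swap V).
Proof. by case=> v a; rewrite /sheet_swap negbK. Qed.

Lemma double_cover_swap (V : finType) (e : rel V) p q :
  double_cover e (sheet_swap p) (sheet_swap q) = double_cover e p q.
Proof. by case: p q => [u []] [v []]. Qed.

(** Along an edge of the cover both colour and sheet change, so their sum is constant on components,
    whereas exchanging the sheets changes it. *)
Lemma double_cover_free (V : finType) (e : rel V) (col : V -> bool) p :
  (forall x y, e x y -> col x != col y) ->
  ~~ connect (double_cover e) p (sheet_swap p).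
Proof.
move=> colP; apply/negP => /(connect_homo (r' := eq_op)
  (f := fun q => col q.1 (+) q.2)) conn.
have /connectP[s pth] : connect eq_op (col p.1 (+) p.2) (col p.1 (+) ~~ p.2).
  apply: conn => -[x a] [y b] /=/andP[+ /colP].
  by case: a; case: b; case: (col x); case: (col y).
have -> : last (col p.1 (+) p.2) s = col p.1 (+) p.2.
  by elim: s (col p.1 (+) p.2) pth => //= y s IHs x /andP[/eqP<- /IHs].
by case: (col p.1); case: p.2.
Qed.

(** [flip_colouring] is applied to the sheet exchange of the first cover and to that of the second,
    transported by [g]. The points where [k] holds then form exactly one lift of each vertex of
    either graph, and [g] matches these lifts. *)
Lemma double_cover_cancel (V1 V2 : finType) (e1 : rel V1) (e2 : rel V2)
    (col1 : V1 -> bool) (col2 : V2 -> bool) (g : V1 * bool -> V2 * bool) :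
  symmetric e1 ->
  (forall x y, e1 x y -> col1 x != col1 y) ->
  (forall x y, e2 x y -> col2 x != col2 y) ->
  bijective g ->
  (forall p q, double_cover e2 (g p) (g q) = double_cover e1 p q) ->
  exists2 f : V1 -> V2, bijective f & forall x y, e2 (f x) (f y) = e1 x y.
Proof.
move=> sym1 colP1 colP2 [g' gK g'K] gE.
have gE' p q : double_cover e1 (g' p) (g' q) = double_cover e2 p q.
  by rewrite -gE !g'K.
pose s2 p := g' (sheet_swap (g p)).
have [||||||| k [ke k1 k2]] := @flip_colouring _ (double_cover e1)
    (@sheet_swap V1) s2.
- by move=> p q; rewrite /double_cover /= eq_sym sym1.
- exact: sheet_swapK.
- by move=> p; rewrite /s2 g'K sheet_swapK gK.
- exact: double_cover_swap.
- by move=> p q; rewrite /s2 gE' double_cover_swap gE.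
- by move=> p; apply: double_cover_free colP1.
- move=> p; apply: contraNN (double_cover_free (g p) colP2).
  move=> /(connect_homo (r' := double_cover e2) (f := g)).
  by rewrite /s2 g'K; apply=> a b; rewrite gE.
pose lift v := (v, k (v, true)).
have liftk v : k (lift v).
  rewrite /lift; case kv: (k (v, true)) => //.
  by rewrite (k1 (v, true)) kv.
pose f v := (g (lift v)).1.
have gswap p : k (g' (sheet_swap p)) = ~~ k (g' p).
  by rewrite -k2 /s2 g'K.
have kinj p q : k (g' p) -> k (g' q) -> p.1 = q.1 -> p = q.
  case: p => x a; case: q => y b kp kq /= xy; rewrite {}xy in kp *.
  congr (_, _); apply/eqP; apply: contraTT kp => ab.
  have -> : (y, a) = sheet_swap (y, b) by case: (a) (b) ab => [] [].
  by rewrite gswap kq.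
have finj : injective f.
  move=> u v fuv; suff /(congr1 fst) : lift u = lift v by [].
  by apply: (can_inj gK); apply: kinj; rewrite ?gK.
have card_le : #|V2| <= #|V1|.
  have /bij_eq_card : bijective g by exists g'.
  by rewrite !card_prod card_bool => /eqP; rewrite eqn_pmul2r // => /eqP->.
exists f; first exact: inj_card_bij.
have coverE (V : finType) (e : rel V) p q : e p.1 q.1 =
    double_cover e p q || double_cover e p (sheet_swap q).
  by rewrite /double_cover /= -andb_orl; case: p.2 q.2 => [] [].
move=> u v; rewrite [LHS]coverE [RHS](coverE _ e1 (lift u) (lift v)) gE.
(* Edges preserve [k], so the second disjunct, joining a chosen lift to a rejected one, is false on
   both sides. *)
congr (_ || _); transitivity false.
  apply/negbTE/negP; rewrite -gE' => /ke; rewrite gswap !gK !liftk.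
  by [].
by apply/esym/negbTE/negP => /ke; rewrite k1 !liftk.
Qed.

End DoubleCover.

(** * Row spaces of isotropic matroids *)

(* [(v, Phi)], [(v, Chi)] and [(v, Psi)] stand for the columns of the vertex [v]
   in the blocks [I], [A] and [I + A]. *)
Notation Phi := None.
Notation Chi := (Some true).
Notation Psi := (Some false).

Lemma third_role (k k' : option bool) : exists k'', k != k'' /\ k' != k''.
Proof.
case: k => [[]|]; case: k' => [[]|];
  solve [by exists Phi | by exists Chi | by exists Psi].
Qed.

Section IsotropicRows.
Variables (V : finType) (e : rel V).
Implicit Types (F : V * option bool -> bool) (u v w x y : V).
Hypotheses (e_sym : symmetric e) (e_irr : irreflexive e).

Definition iso_rows F := forall v,
  F (v, Chi) = \xor_(u | e v u) F (u, Phi) /\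
  F (v, Psi) = F (v, Phi) (+) F (v, Chi).

Lemma eq_iso_rows F F' : F =1 F' -> iso_rows F -> iso_rows F'.
Proof.
move=> FF' rF v; have [Fc Fp] := rF v; rewrite -!FF'; split=> //.
by rewrite Fc; apply: eq_bigr => u _.
Qed.

Definition unit_row x (z : V * option bool) :=
  if z.2 is Some k then (if k then e z.1 x else (z.1 == x) (+) e z.1 x)
  else z.1 == x.

Lemma unit_rowP x : iso_rows (unit_row x).
Proof. by move=> v; rewrite /unit_row /= xor_pred1. Qed.

(** Equality of columns; two zero columns count as parallel too. *)
Definition parallel z z' := forall F, iso_rows F -> F z = F z'.

Lemma parallel_unit z z' : parallel z z' -> forall x, unit_row x z = unit_row x z'.
Proof. by move=> zz' x; apply: zz'; apply: unit_rowP. Qed.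

Lemma parallel_leaf x w : is_leaf e x w -> parallel (w, Phi) (x, Chi).
Proof. by move=> lf F rF; case: (rF x) => -> _; rewrite (xor_leaf _ lf). Qed.

Lemma parallel_Phi_inj u v : parallel (u, Phi) (v, Phi) -> u = v.
Proof.
by move=> /parallel_unit/(_ u); rewrite /unit_row /= eqxx => /esym/eqP.
Qed.

Lemma parallel_PhiP y k c : parallel (c, Phi) (y, k) ->
  [\/ y = c /\ k = Phi, is_leaf e y c /\ k = Chi
   | [/\ y = c, k = Psi & forall v, e c v = false]].
Proof.
move=> pr; have row v := parallel_unit pr v.
case: k => [[]|] in pr row *; rewrite /unit_row /= in row.
- by constructor 2; split=> // v; rewrite -row eq_sym.
- constructor 3; have yc : y = c.
    apply/eqP; have := row y; rewrite eqxx e_irr eq_sym.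
    by case: (y == c).
  rewrite yc in row; split=> // v.
  by have := row v; case: (c == v); case: (e c v).
- by constructor 1; rewrite (parallel_Phi_inj pr).
Qed.

(** A row sums to zero on each triple, a relation in which the three roles are interchangeable. *)
Lemma iso_rows_third F v k1 k2 k3 : iso_rows F ->
  k1 != k2 -> k1 != k3 -> k2 != k3 -> F (v, k3) = F (v, k1) (+) F (v, k2).
Proof.
move=> rF; have [_ Fp] := rF v.
case: k1 k2 k3 => [[]|] [[]|] [[]|] //= _ _ _; rewrite Fp;
  by case: (F (v, Phi)); case: (F (v, Chi)).
Qed.

Lemma unit_row_nonzero F z : iso_rows F -> F z -> exists d, unit_row d z.
Proof.
case: z => y [[]|] rF; rewrite /unit_row /=.
- have [-> _] := rF y => Fy; apply/existsP; apply: contraLR Fy => /existsPn none.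
  by rewrite big1 // => u; rewrite (negbTE (none u)).
- by exists y; rewrite eqxx e_irr.
- by exists y; rewrite eqxx.
Qed.

Hypothesis e_deg1 : one_degenerate e.

(** Without squares, equal [Chi] columns of distinct vertices have a single entry. Equal [Psi]
    columns belong to adjacent vertices, which without triangles have no further neighbours. A [Chi]
    and a [Psi] column never agree if both vertices differ or coincide, and [d] excludes zero
    columns. *)
Lemma parallel_cases z z' d : parallel z z' -> z != z' -> unit_row d z ->
  (exists c, parallel (c, Phi) z) \/
  exists y y', [/\ z = (y, Psi), z' = (y', Psi), is_leaf e y y' & is_leaf e y' y].
Proof.
case: z z' => y k [y' k'] pr zz' dz; have row v := parallel_unit pr v.
have chi_psi a a' : (forall v, e a v = (a' == v) (+) e a' v) -> False.
  move=> aa'; have := aa' a'; have := aa' a; rewrite eqxx !e_irr /= (e_sym a').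
  case: eqVneq => [->|_]; rewrite /= ?e_irr // => H.
  by rewrite -H.
case: k k' => [[]|] [[]|] in pr zz' dz row *; rewrite /unit_row /= in dz row.
- have yy' : y != y' by apply: contraNneq zz' => ->.
  left; exists d => F rF; have [-> _] := rF y.
  rewrite (big_pred1 d) // => v; apply/idP/eqP => [eyv|-> //].
  apply: (one_degenerate_square e_sym e_deg1 eyv dz _ _ yy').
    by rewrite -row.
  by rewrite -row.
- by case: (chi_psi y y').
- by left; exists y' => F rF; rewrite (pr _ rF).
- by case: (chi_psi y' y).
- have yy' : y != y' by apply: contraNneq zz' => ->.
  have eyy' : e y y'.
    by have := row y'; rewrite eqxx e_irr (negbTE yy') /= => ->.
  have tri v : e y v -> e y' v -> False.
    move=> eyv ey'v; apply: (one_degenerate_triangle e_sym e_irr e_deg1 eyy' ey'v eyv).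
  right; exists y, y'; split=> // v; apply/idP/eqP => [ev|->]; rewrite // 1?e_sym //.
    apply/esym/eqP; apply: contraT => y'v; have := row v.
    have yv : y != v by apply: contraTneq ev => ->; rewrite e_irr.
    by rewrite (negbTE yv) (negbTE y'v) ev /= => /esym/(tri _ ev).
  apply/esym/eqP; apply: contraT => yv; have := row v.
  have y'v : y' != v by apply: contraTneq ev => ->; rewrite e_irr.
  by rewrite (negbTE yv) (negbTE y'v) ev /= => /tri/(_ ev).
- by left; exists y' => F rF; rewrite (pr _ rF).
- by left; exists y => F rF.
- by left; exists y => F rF.
- by left; exists y => F rF.
Qed.

(** For each choice of roles the sum is the neighbourhood of [d] without [u], possibly with [d]
    added. As it is the unit vector at [c], either [d] has exactly the neighbours [c] and [u], or
    [c = d] and [u] is its only neighbour. *)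
Lemma split_hub u d ku kd c b : is_leaf e u d -> is_leaf e b c ->
  kd != Phi -> ku != Chi ->
  (forall v, unit_row v (d, kd) (+) unit_row v (u, ku) = (c == v)) ->
  [/\ c = d, is_leaf e d u & (kd, ku) = (Psi, Phi) \/ (kd, ku) = (Chi, Psi)]
  \/ [/\ forall v, e d v = (v == c) || (v == u), c != u, c != d
       & (kd, ku) = (Chi, Phi) \/ (kd, ku) = (Psi, Psi)].
Proof.
move=> lfu lfb kd0 ku1 row; have ud := leaf_irr e_irr lfu.
have edu : e d u by rewrite e_sym lfu.
have hub (P : forall v, e d v (+) (u == v) = (c == v)) :
    [/\ forall v, e d v = (v == c) || (v == u), c != u & c != d].
  have cu : c != u by have := P u; rewrite edu eqxx /= => /esym/negbT.
  have cd : c != d by have := P d; rewrite e_irr (negbTE ud) /= => /esym/negbT.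
  split=> // v; have := P v; rewrite !(eq_sym _ v).
  case: (eqVneq v u) => [->|_]; first by rewrite edu orbT.
  by rewrite addbF orbF.
have end_hub (P : forall v, (d == v) (+) e d v (+) (u == v) = (c == v)) :
    c = d /\ is_leaf e d u.
  have cd : c = d.
    by apply/eqP; rewrite -P eqxx e_irr (negbTE ud).
  split=> // v; have := P v; rewrite cd (eq_sym u).
  by case: (d == v); case: (e d v); case: (v == u).
case: kd ku kd0 ku1 row => [[]|] [[]|] // _ _ row; rewrite /unit_row /= in row.
- have [|cd lfd] := end_hub; last by left; split=> //; right.
  move=> v; rewrite -row lfu (eq_sym v).
  by case: (d == v); case: (e d v); case: (u == v).
- by have [//|P cu cd] := hub; right; split=> //; left.
- have [|P cu cd] := hub; last by right; split=> //; right.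
  move=> v; rewrite -row lfu (eq_sym v).
  by case: (d == v); case: (e d v); case: (u == v).
- have [|cd lfd] := end_hub; last by left; split=> //; left.
  by move=> v; rewrite -row.
Qed.

(* If [phi_c] is in two ways the sum of an element of one triple and an element
   of another one, then [c] lies in an edge component or the two triples belong
   to a leaf [u] and its neighbour [d] of degree two adjacent to [c]. *)
Lemma split_lines y y' k1 k2 k1' k2' c b :
  is_leaf e b c -> y != y' -> k1 != k2 -> k1' != k2' ->
  (forall F, iso_rows F -> F (y, k1) (+) F (y', k1') = F (c, Phi)) ->
  (forall F, iso_rows F -> F (y, k2) (+) F (y', k2') = F (c, Phi)) ->
  exists u d ku kd,
    [/\ is_leaf e u d,
        [/\ (y, k1) = (d, kd), (y', k1') = (u, ku) & k2' != Chi] \/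
        [/\ (y, k1) = (u, ku), (y', k1') = (d, kd) & k2 != Chi]
      & [/\ c = d, is_leaf e d u & (kd, ku) = (Psi, Phi) \/ (kd, ku) = (Chi, Psi)]
        \/ [/\ forall v, e d v = (v == c) || (v == u), c != u, c != d
             & (kd, ku) = (Chi, Phi) \/ (kd, ku) = (Psi, Psi)]].
Proof.
move=> lfb yy' k12 k12' F1 F2.
have [k3 [k13 k23]] := third_role k1 k2.
have [k3' [k13' k23']] := third_role k1' k2'.
have pr : parallel (y, k3) (y', k3').
  move=> F rF; rewrite (iso_rows_third _ rF k12 k13 k23).
  rewrite (iso_rows_third _ rF k12' k13' k23').
  move: (F1 _ rF); rewrite -(F2 _ rF).
  by case: (F _); case: (F _); case: (F _); case: (F _).
have row v : unit_row v (y, k1) (+) unit_row v (y', k1') = (c == v).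
  by rewrite (F1 _ (unit_rowP v)).
have prow v := parallel_unit pr v.
have yy'F := negbTE yy'; have y'yF : (y' == y) = false by rewrite eq_sym.
case: k3 k3' => [[]|] [[]|] in pr prow k13 k23 k13' k23' *;
  rewrite /unit_row /= in prow.
- have eyy' : e y y' = false by rewrite prow e_irr.
  have ey'y : e y' y = false by rewrite -prow e_irr.
  have cE z : (z == y) || (z == y') -> c = z.
    move=> zE; apply/eqP; rewrite -row.
    case: k1 k13 {F1 F2 row k12} => [[]|] //; case: k1' k13' {k12'} => [[]|] //;
      rewrite /unit_row /=; case/orP: zE => /eqP->;
      by rewrite ?eqxx ?e_irr ?eyy' ?ey'y ?yy'F ?y'yF.
  by rewrite -(cE y) ?eqxx // -(cE y') ?eqxx ?orbT in yy'.
- by have := prow y'; have := prow y; rewrite !eqxx !e_irr (e_sym y') y'yF /= => <-.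
- have lf : is_leaf e y y' by move=> v; rewrite prow eq_sym.
  exists y, y', k1, k1'; split=> //; first by right.
  by apply: (split_hub lf lfb) => // v; rewrite addbC row.
- by have := prow y'; have := prow y; rewrite !eqxx !e_irr (e_sym y') yy'F /= => <-.
- have eyy' : e y y' by have := prow y'; rewrite eqxx e_irr yy'F /= => ->.
  have ey'y : e y' y by rewrite e_sym.
  have tri v : e y v -> e y' v -> False.
    by move=> eyv ey'v; apply: (one_degenerate_triangle e_sym e_irr e_deg1 eyy' ey'v).
  have rowy := row y; have rowy' := row y'; have rowc := row c.
  rewrite eqxx in rowc.
  clear F1 F2 k12 k12' row; case: k1 k13 rowy rowy' rowc => [[]|] //= _;
  case: k1' k13' => [[]|] //= _; rewrite /unit_row /= ?eqxx ?e_irr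
    ?eyy' ?ey'y ?yy'F ?y'yF /=.
  + by move=> /esym/eqP-> /esym; rewrite yy'F.
  + have := prow c; rewrite !(eq_sym _ c) => + cy cy'; rewrite -cy -cy' /=.
    by case eyc: (e y c); case ey'c: (e y' c) => //; case: (tri _ eyc ey'c).
  + have := prow c; rewrite !(eq_sym _ c) => + cy cy'; rewrite -cy -cy' /=.
    by case eyc: (e y c); case ey'c: (e y' c) => //; case: (tri _ eyc ey'c).
  + by move=> /esym/eqP-> /esym; rewrite yy'F.
- by have := prow y; rewrite eqxx y'yF e_irr.
- have lf : is_leaf e y' y by move=> v; rewrite -prow eq_sym.
  exists y', y, k1', k1; split=> //; first by left.
  exact: split_hub lfb _ _ row.
- by have := prow y'; rewrite eqxx yy'F e_irr.
- by have := prow y; rewrite eqxx y'yF.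
Qed.

(* [leaf_complement] and [leaf_pivot] are the local complementation at the leaf
   [b] and the pivot on the edge [bc]; both return an isomorphic forest. *)
Definition leaf_complement b c (z : V * option bool) :=
  if z.1 == b then (b, match z.2 with Phi => Psi | Psi => Phi | _ => Chi end)
  else if z.1 == c then
    (c, match z.2 with Chi => Psi | Psi => Chi | _ => Phi end)
  else z.

Definition leaf_pivot b c (z : V * option bool) :=
  if z.1 == b then match z.2 with Phi => (c, Chi) | Psi => (c, Psi) | _ => z end
  else if z.1 == c then
    match z.2 with Chi => (b, Phi) | Psi => (b, Psi) | _ => z end
  else z.

(* In a component that is the path [b c d u] the columns outside the two parallel
   classes form two cosets of the plane spanned by [phi_c] and [phi_d];
   this exchanges the cosets. *)
Definition path_swap b c d u (z : V * option bool) :=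
  if z.1 == b then match z.2 with Phi => (u, Phi) | Psi => (d, Chi) | _ => z end
  else if z.1 == c then
    match z.2 with Chi => (u, Psi) | Psi => (d, Psi) | _ => z end
  else if z.1 == d then
    match z.2 with Chi => (b, Psi) | Psi => (c, Psi) | _ => z end
  else if z.1 == u then
    match z.2 with Phi => (b, Phi) | Psi => (c, Chi) | _ => z end
  else z.

Lemma leaf_complementK b c : b != c -> involutive (leaf_complement b c).
Proof.
move=> bc [v k]; rewrite /leaf_complement /=.
case: (eqVneq v b) => [->|vb]; first by case: k => [[]|]; rewrite /= eqxx.
case: (eqVneq v c) => [->|vc] /=; last by rewrite (negbTE vb) (negbTE vc).
by case: k => [[]|]; rewrite /= eqxx eq_sym (negbTE bc).
Qed.

Lemma leaf_pivotK b c : b != c -> involutive (leaf_pivot b c).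
Proof.
move=> bc [v k]; have cb : (c == b) = false by rewrite eq_sym (negbTE bc).
rewrite /leaf_pivot /=; case: (eqVneq v b) => [->|vb].
  by case: k => [[]|]; rewrite /= ?eqxx ?cb ?eqxx.
case: (eqVneq v c) => [->|vc] /=; last by rewrite (negbTE vb) (negbTE vc).
by case: k => [[]|]; rewrite /= ?eqxx ?cb ?eqxx.
Qed.

Lemma path_swapK b c d u : uniq [:: b; c; d; u] -> involutive (path_swap b c d u).
Proof.
rewrite /= !inE !negb_or andbT => /and3P[/and3P[bc bd bu] /andP[cd cu] du].
have cb : (c == b) = false by rewrite eq_sym (negbTE bc).
have db : (d == b) = false by rewrite eq_sym (negbTE bd).
have ub : (u == b) = false by rewrite eq_sym (negbTE bu).
have dc : (d == c) = false by rewrite eq_sym (negbTE cd).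
have uc : (u == c) = false by rewrite eq_sym (negbTE cu).
have ud : (u == d) = false by rewrite eq_sym (negbTE du).
move=> [v k]; rewrite /path_swap /=; case: (eqVneq v b) => [->|vb].
  by case: k => [[]|]; rewrite /= ?eqxx ?cb ?db ?ub ?dc ?uc ?ud ?eqxx.
case: (eqVneq v c) => [->|vc].
  by case: k => [[]|]; rewrite /= ?eqxx ?cb ?db ?ub ?dc ?uc ?ud ?eqxx.
case: (eqVneq v d) => [->|vd].
  by case: k => [[]|]; rewrite /= ?eqxx ?cb ?db ?ub ?dc ?uc ?ud ?eqxx.
case: (eqVneq v u) => [->|vu] /=.
  by case: k => [[]|]; rewrite /= ?eqxx ?cb ?db ?ub ?dc ?uc ?ud ?eqxx.
by rewrite (negbTE vb) (negbTE vc) (negbTE vd) (negbTE vu).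
Qed.

(** As [b] is a leaf, its [Phi] value enters only the sum at [c]; it may change freely if [(c, Chi)]
    changes by the same amount and the [Psi] values follow. *)
Lemma iso_rows_leaf_change F F' b c : is_leaf e b c -> iso_rows F ->
  (forall v k, v != b -> v != c -> F' (v, k) = F (v, k)) ->
  F' (c, Phi) = F (c, Phi) -> F' (b, Chi) = F (c, Phi) ->
  F' (b, Psi) = F' (b, Phi) (+) F' (b, Chi) ->
  F' (c, Chi) = F (c, Chi) (+) F (b, Phi) (+) F' (b, Phi) ->
  F' (c, Psi) = F' (c, Phi) (+) F' (c, Chi) -> iso_rows F'.
Proof.
move=> lf rF out Fc Fb1 Fb2 Fc1 Fc2 v.
have phi y : y != b -> F' (y, Phi) = F (y, Phi).
  by case: (eqVneq y c) => [->|yc yb] //; rewrite out.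
have [->|vb] := eqVneq v b; first by rewrite Fb2 (xor_leaf _ lf) Fb1 Fc.
have [->|vc] := eqVneq v c.
  split=> //; rewrite Fc1; case: (rF c) => -> _.
  rewrite !(xor_cut_hub e_sym e_irr _ lf).
  rewrite (eq_bigr (fun y => F (y, Phi)) (F1 := fun y => F' (y, Phi))).
    by case: (F (b, _)); case: (F' (b, _)); case: (\xor_(_ | _) _).
  by move=> y; rewrite (cut_leafE e_sym _ _ lf) => /and3P[_ _ /phi].
rewrite !out //; case: (rF v) => -> ->; split=> //.
apply: eq_bigr => y evy; rewrite phi //; apply: contraNneq vc => yb.
by move: evy; rewrite yb e_sym lf.
Qed.

Lemma leaf_complement_rows b c F : is_leaf e b c -> iso_rows F ->
  iso_rows (F \o leaf_complement b c).
Proof.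
move=> lf rF; have bc := leaf_irr e_irr lf.
have cb : (c == b) = false by rewrite eq_sym (negbTE bc).
have [_ Fb] := rF b; have [_ Fc] := rF c; have pr := parallel_leaf lf rF.
apply: (iso_rows_leaf_change lf rF) => [v k vb vc|||||];
  rewrite /= /leaf_complement /= ?eqxx ?cb ?eqxx //= ?Fb ?Fc ?pr //.
- by rewrite (negbTE vb) (negbTE vc).
- by case: (F (b, Phi)); case: (F (b, Chi)).
- by case: (F (b, Phi)); case: (F (b, Chi)); case: (F (c, Chi)).
- by case: (F (b, Chi)); case: (F (c, Chi)).
Qed.

Lemma leaf_pivot_rows b c F : is_leaf e b c -> iso_rows F ->
  iso_rows (F \o leaf_pivot b c).
Proof.
move=> lf rF; have bc := leaf_irr e_irr lf.
have cb : (c == b) = false by rewrite eq_sym (negbTE bc).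
have [_ Fb] := rF b; have [_ Fc] := rF c; have pr := parallel_leaf lf rF.
apply: (iso_rows_leaf_change lf rF) => [v k vb vc|||||];
  rewrite /= /leaf_pivot /= ?eqxx ?cb ?eqxx //= ?Fb ?Fc ?pr //.
- by rewrite (negbTE vb) (negbTE vc).
- by rewrite addbC.
- by case: (F (b, Phi)); case: (F (c, Chi)).
- by rewrite addbC.
Qed.

(** The four vertices form a whole component, so all values there are sums of the four [Phi] values
    and can be compared directly. *)
Lemma path_swap_rows b c d u F : uniq [:: b; c; d; u] ->
  is_leaf e b c -> is_leaf e u d ->
  (forall v, e c v = (v == b) || (v == d)) ->
  (forall v, e d v = (v == c) || (v == u)) ->
  iso_rows F -> iso_rows (F \o path_swap b c d u).
Proof.
rewrite /= !inE !negb_or andbT => /and3P[/and3P[bc bd bu] /andP[cd cu] du].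
have cb : (c == b) = false by rewrite eq_sym (negbTE bc).
have db : (d == b) = false by rewrite eq_sym (negbTE bd).
have ub : (u == b) = false by rewrite eq_sym (negbTE bu).
have dc : (d == c) = false by rewrite eq_sym (negbTE cd).
have uc : (u == c) = false by rewrite eq_sym (negbTE cu).
have ud : (u == d) = false by rewrite eq_sym (negbTE du).
move=> lfb lfu nc nd rF.
have sum2 x y1 y2 (f : V -> bool) : y1 != y2 ->
    (forall v, e x v = (v == y1) || (v == y2)) ->
    \xor_(v | e x v) f v = f y1 (+) f y2.
  move=> y12 nx; rewrite (bigD1 y1) ?nx ?eqxx //=; congr (_ (+) _).
  apply: big_pred1 => v; rewrite nx.
  by rewrite /=; case: (eqVneq v y1) => [->|_]; rewrite ?andbT ?andbF ?(negbTE y12).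
have sumc f := sum2 c b d f bd nc; have sumd f := sum2 d c u f cu nd.
have [Fb1 Fb] := rF b; have [Fc1 Fc] := rF c.
have [Fd1 Fd] := rF d; have [Fu1 Fu] := rF u.
rewrite (xor_leaf _ lfb) in Fb1; rewrite (xor_leaf _ lfu) in Fu1.
rewrite sumc in Fc1; rewrite sumd in Fd1.
move=> v; have [->|vb] := eqVneq v b.
  rewrite (xor_leaf _ lfb) /= /path_swap /= ?eqxx ?cb ?db ?ub ?dc ?uc ?ud ?eqxx /=.
  by rewrite Fb1 Fd1 addbC.
have [->|vc] := eqVneq v c.
  rewrite sumc /= /path_swap /= ?eqxx ?cb ?db ?ub ?dc ?uc ?ud ?eqxx /=.
  rewrite Fd Fu Fu1 Fd1; split=> //.
  by case: (F (c, Phi)); case: (F (d, Phi)); case: (F (u, Phi)).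
have [->|vd] := eqVneq v d.
  rewrite sumd /= /path_swap /= ?eqxx ?cb ?db ?ub ?dc ?uc ?ud ?eqxx /=.
  rewrite Fb Fc Fb1 Fc1 addbC; split=> //.
  by case: (F (c, Phi)); case: (F (d, Phi)); case: (F (b, Phi)).
have [->|vu] := eqVneq v u.
  rewrite (xor_leaf _ lfu) /= /path_swap /= ?eqxx ?cb ?db ?ub ?dc ?uc ?ud ?eqxx /=.
  by rewrite Fu1 Fc1.
have off k : path_swap b c d u (v, k) = (v, k).
  by rewrite /path_swap /= (negbTE vb) (negbTE vc) (negbTE vd) (negbTE vu).
rewrite /= !off; case: (rF v) => -> ->; split=> //.
apply: eq_bigr => y evy; rewrite /= /path_swap /=.
have [yb|_] := eqVneq y b; first by move: evy; rewrite yb e_sym lfb (negbTE vc).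
have [_|_] := eqVneq y c; first by [].
have [_|_] := eqVneq y d; first by [].
have [yu|//] := eqVneq y u; by move: evy; rewrite yu e_sym lfu (negbTE vd).
Qed.

Lemma parallel_swap_rows z z' F : parallel z z' -> iso_rows F ->
  iso_rows (F \o tperm z z').
Proof.
move=> pr rF; apply: eq_iso_rows (rF) => s /=; case: tpermP => [->|->|//].
  exact: pr.
by rewrite (pr _ rF).
Qed.

Lemma unit_row_leaf x w z : is_leaf e x w -> unit_row x z =
  \big[addb/false]_(s <- [:: (x, Phi); (x, Psi); (w, Chi); (w, Psi)]) (z == s).
Proof.
move=> lf; have xw := leaf_irr e_irr lf.
rewrite !big_cons big_nil /unit_row; case: z => v k; rewrite !xpair_eqE /=.
rewrite (e_sym v) lf; case: k => [[]|]; rewrite /= ?andbF ?andbT ?addbF ?addFb //.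
Qed.

End IsotropicRows.

Definition contract_leaf (V : finType) (x w : V) (F : V * option bool -> bool) z :=
  if z.1 == x then (if z.2 is Phi then false else F (w, Phi)) else F z.

(** After the cut, the common value at [(x, Phi)] and [(x, Psi)] is free, and the rest is a row of
    [e] vanishing at [(x, Phi)]. Again [e] enters only through its row space. *)
Lemma iso_rows_cut (V : finType) (e : rel V) x w F :
  symmetric e -> irreflexive e -> is_leaf e x w ->
  iso_rows (cut e x w) F <->
  [/\ F (x, Chi) = false, F (x, Psi) = F (x, Phi)
    & iso_rows e (contract_leaf x w F)].
Proof.
move=> e_sym e_irr lf; have xw := leaf_irr e_irr lf.
have wx : (w == x) = false by rewrite eq_sym (negbTE xw).
have sumE v : v != x -> \xor_(u | e v u) contract_leaf x w F (u, Phi) =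
    \xor_(u | cut e x w v u) F (u, Phi).
  move=> vx; rewrite big_mkcond [RHS]big_mkcond; apply: eq_bigr => u _.
  rewrite (cut_leafE e_sym _ _ lf) vx /contract_leaf /=.
  by case: (e v u); case: (u == x).
split=> [rF|[Fc Fp rF] v]; first split.
- by case: (rF x) => -> _; rewrite (xor_cut_leaf e_sym _ lf).
- by case: (rF x) => -> ->; rewrite (xor_cut_leaf e_sym _ lf) addbF.
- move=> v; have [->|vx] := eqVneq v x.
    by rewrite (xor_leaf _ lf) /contract_leaf /= eqxx wx.
  by rewrite sumE // /contract_leaf /= (negbTE vx).
have [->|vx] := eqVneq v x.
  by rewrite (xor_cut_leaf e_sym _ lf) Fc Fp addbF.
by have := rF v; rewrite sumE // /contract_leaf /= (negbTE vx).
Qed.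

(** * Isomorphisms of isotropic row spaces and the images of triples *)

Definition row_iso (V1 V2 : finType) (e1 : rel V1) (e2 : rel V2)
    (th : V1 * option bool -> V2 * option bool) th' :=
  [/\ cancel th th', cancel th' th
    & forall F, iso_rows e2 F <-> iso_rows e1 (F \o th)].

Definition forest_rel (V : finType) (e : rel V) :=
  [/\ symmetric e, irreflexive e & one_degenerate e].

Section RowIso.
Variables (V1 V2 : finType) (e1 : rel V1) (e2 : rel V2).
Variables (th : V1 * option bool -> V2 * option bool).
Variables (th' : V2 * option bool -> V1 * option bool).
Hypotheses (f1 : forest_rel e1) (f2 : forest_rel e2).
Hypothesis iso : row_iso e1 e2 th th'.

Lemma row_iso_sym : row_iso e2 e1 th' th.
Proof.
have [thK thK' rows] := iso; split=> // F; rewrite rows.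
by split; apply: eq_iso_rows => z; rewrite /= thK.
Qed.

Lemma row_iso_parallel z z' : parallel e1 z z' -> parallel e2 (th z) (th z').
Proof. by have [_ _ rows] := iso; move=> pr F /rows/pr. Qed.

Lemma row_iso_third v1 k1 k2 k3 F : iso_rows e2 F ->
  k1 != k2 -> k1 != k3 -> k2 != k3 ->
  F (th (v1, k3)) = F (th (v1, k1)) (+) F (th (v1, k2)).
Proof.
have [_ _ rows] := iso => /rows rF k12 k13 k23.
exact: (iso_rows_third v1 rF k12 k13 k23).
Qed.

(** The image of [S] is again a row, and every row sums to zero on each triple. *)
Lemma row_iso_parity (S : seq (V1 * option bool)) :
  iso_rows e1 (fun z => \big[addb/false]_(s <- S) (z == s)) ->
  forall v, \big[addb/false]_(s <- S) ((th s).1 == v) = false.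
Proof.
have [thK thK' rows] := iso => rS v.
have r2 : iso_rows e2 (fun z => \big[addb/false]_(s <- S) (z == th s)).
  apply/rows; apply: eq_iso_rows rS => z /=; apply: eq_bigr => s _.
  by rewrite (inj_eq (can_inj thK)).
have [_ sumPsi] := r2 v.
transitivity ((\big[addb/false]_(s <- S) ((v, Phi) == th s) (+)
  \big[addb/false]_(s <- S) ((v, Chi) == th s)) (+)
  \big[addb/false]_(s <- S) ((v, Psi) == th s)); last by rewrite sumPsi addbb.
rewrite -!big_split /=; apply: eq_bigr => s _.
case: (th s) => y k; rewrite !xpair_eqE /= (eq_sym y).
by case: k => [[]|]; case: (v == y).
Qed.

Lemma row_iso_no_four zs v :
  uniq zs -> all (fun z => (th z).1 == v) zs -> size zs <= 3.
Proof.
have [thK _ _] := iso => unq /allP same.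
have : uniq (map (fun z => (th z).2) zs).
  rewrite map_inj_in_uniq // => z1 z2 /same/eqP E1 /same/eqP E2 E.
  by apply: (can_inj thK); rewrite [LHS]surjective_pairing E1 E -E2 -surjective_pairing.
move/card_uniqP; rewrite size_map => <-.
by apply: leq_trans (max_card _) _; rewrite card_option card_bool.
Qed.

Lemma row_iso_triple a z b :
  (forall k, (th (a, k)).1 = b) -> (th z).1 = b -> z.1 = a.
Proof.
move=> ab zb; apply/eqP; apply: contraT => za.
suff : 4 <= 3 by [].
apply: (@row_iso_no_four [:: (a, Phi); (a, Chi); (a, Psi); z] b); last first.
  by rewrite /= !ab zb eqxx.
by rewrite /= !inE; case: z za {zb} => y k /= ya; rewrite !xpair_eqE
  ![a == y]eq_sym (negbTE ya) /= !andbF.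
Qed.

Lemma row_iso_parity_leaf x w v : is_leaf e1 x w ->
  ((th (x, Phi)).1 == v) (+) ((th (x, Psi)).1 == v) (+)
  ((th (w, Chi)).1 == v) (+) ((th (w, Psi)).1 == v) = false.
Proof.
move=> lf; have [e1_sym e1_irr _] := f1.
have := row_iso_parity (S := [:: (x, Phi); (x, Psi); (w, Chi); (w, Psi)]).
move=> /(_ (eq_iso_rows (fun z => unit_row_leaf e1_sym e1_irr z lf)
  (unit_rowP e1 x)) v).
by rewrite !big_cons big_nil addbF !addbA.
Qed.

(** By parity the images of the four elements in the row of the leaf [x] fall into triples in pairs,
    and all four do not fit into one triple. *)
Lemma row_iso_pairing x w : is_leaf e1 x w ->
  [\/ [/\ (th (x, Phi)).1 = (th (x, Psi)).1, (th (w, Chi)).1 = (th (w, Psi)).1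
        & (th (x, Phi)).1 != (th (w, Chi)).1],
      [/\ (th (x, Phi)).1 = (th (w, Chi)).1, (th (x, Psi)).1 = (th (w, Psi)).1
        & (th (x, Phi)).1 != (th (x, Psi)).1]
    | [/\ (th (x, Phi)).1 = (th (w, Psi)).1, (th (x, Psi)).1 = (th (w, Chi)).1
        & (th (x, Phi)).1 != (th (x, Psi)).1]].
Proof.
move=> lf; have [e1_sym e1_irr _] := f1; have xw := leaf_irr e1_irr lf.
have par4 v := row_iso_parity_leaf v lf.
have not4 : ~ [/\ (th (x, Psi)).1 = (th (x, Phi)).1,
    (th (w, Chi)).1 = (th (x, Phi)).1 & (th (w, Psi)).1 = (th (x, Phi)).1].
  case=> E1 E2 E3; suff : 4 <= 3 by [].
  apply: (@row_iso_no_four [:: (x, Phi); (x, Psi); (w, Chi); (w, Psi)]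
    (th (x, Phi)).1); last by rewrite /= E1 E2 E3 eqxx.
  by rewrite /= !inE !xpair_eqE /= (negbTE xw) !andbF.
move: par4 not4; set A := (th (x, Phi)).1; set B := (th (x, Psi)).1.
set C := (th (w, Chi)).1; set D := (th (w, Psi)).1 => par4 not4.
have pA := par4 A; have pB := par4 B; have pC := par4 C.
rewrite eqxx in pA; rewrite eqxx in pB; rewrite eqxx in pC.
have [BA|BA] := eqVneq B A.
  constructor 1; rewrite BA eqxx addbb addFb in pA.
  rewrite BA addbb addFb addTb in pC; rewrite BA.
  have [CA|CA] := eqVneq C A.
    rewrite CA eqxx addTb in pA.
    by case: not4; split=> //; apply/eqP; case: (D == A) pA.
  by split=> //; apply/esym/eqP; case: (D == C) pC.
have AB : (A == B) = false by rewrite eq_sym (negbTE BA).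
rewrite (negbTE BA) addbF addTb in pA; rewrite AB addFb addTb in pB.
have [CA|CA] := eqVneq C A.
  constructor 2; rewrite CA AB in pB *; split=> //.
  by apply/esym/eqP; case: (D == B) pB.
constructor 3; rewrite (negbTE CA) in pA.
have DA : D = A by apply/eqP; case: (D == A) pA.
rewrite DA AB addbF in pB; split=> //.
by apply/esym/eqP; case: (C == B) pB.
Qed.

(** The images of [(a, j1)] and [(a, j2)] sum to that of [(a, j3)] and also to the third element of
    the triple containing them. That element is thus parallel to [(c, Phi)], and [parallel_PhiP]
    locates it; the leaf [b] shows that [c] is not isolated. *)
Lemma row_iso_special_line a j1 j2 j3 c b :
  j1 != j2 -> j1 != j3 -> j2 != j3 -> is_leaf e2 b c ->
  parallel e2 (c, Phi) (th (a, j3)) -> (th (a, j1)).1 = (th (a, j2)).1 ->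
  [/\ (th (a, j1)).1 = c, (th (a, j1)).2 != Phi & (th (a, j2)).2 != Phi] \/
  [/\ is_leaf e2 (th (a, j1)).1 c, (th (a, j1)).2 != Chi
    & (th (a, j2)).2 != Chi].
Proof.
move=> j12 j13 j23 lfb prc; have [e2_sym e2_irr _] := f2; have [thK _ _] := iso.
case E1: (th (a, j1)) => [y k1]; case E2: (th (a, j2)) => [y' k2] /= yE.
rewrite -{}yE in E2.
have k12 : k1 != k2.
  apply: contraNneq j12 => k12; rewrite k12 -E2 in E1.
  by have [->] := can_inj thK E1.
have [k3 [k13 k23]] := third_role k1 k2.
have : parallel e2 (c, Phi) (y, k3).
  move=> F rF; rewrite (prc F rF) (row_iso_third a rF j12 j13 j23) E1 E2.
  exact/esym/(iso_rows_third y rF k12 k13 k23).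
case/(parallel_PhiP e2_irr)=> [[yc k3E]|[lfy k3E]|[_ _ ec]].
- by left; rewrite -k3E.
- by right; rewrite -k3E.
- by have := ec b; rewrite e2_sym lfb eqxx.
Qed.

(** The images of the two elements at [x] and of the two at [w] both sum to [(c, Phi)]. When those
    at [x] are split, the pairing puts both pairs into the same two triples, as [split_lines]
    requires. *)
Lemma row_iso_split x w b c : is_leaf e1 x w -> is_leaf e2 b c ->
  th (w, Phi) = (c, Phi) -> th (x, Chi) = (b, Chi) ->
  (th (x, Phi)).1 <> (th (x, Psi)).1 ->
  exists u d ku kd jx jx' jw jw', [/\ is_leaf e2 u d,
    [/\ th (x, jx) = (u, ku), th (x, jx') = (d, kd)
      & (jx, jx') = (Phi, Psi) \/ (jx, jx') = (Psi, Phi)],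
    [/\ (th (w, jw)).1 = u, (th (w, jw)).2 != Chi, (th (w, jw')).1 = d
      & (jw, jw') = (Chi, Psi) \/ (jw, jw') = (Psi, Chi)]
    & [/\ c = d, is_leaf e2 d u & (kd, ku) = (Psi, Phi) \/ (kd, ku) = (Chi, Psi)]
      \/ [/\ forall v, e2 d v = (v == c) || (v == u), c != u, c != d
           & (kd, ku) = (Chi, Phi) \/ (kd, ku) = (Psi, Psi)]].
Proof.
move=> lf1 lf2 thw thx xsplit; have [e2_sym e2_irr e2_deg] := f2.
have [thK thK' rows] := iso.
have [_ e1_irr _] := f1; have xw := leaf_irr e1_irr lf1.
have linex F : iso_rows e2 F -> F (th (x, Phi)) (+) F (th (x, Psi)) = F (c, Phi).
  move=> rF; rewrite (parallel_leaf lf2 rF) -thx.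
  by rewrite (row_iso_third x (k1 := Phi) (k2 := Psi) (k3 := Chi) rF).
have linew F : iso_rows e2 F -> F (th (w, Chi)) (+) F (th (w, Psi)) = F (c, Phi).
  by move=> rF; rewrite -thw (row_iso_third w (k1 := Chi) (k2 := Psi) (k3 := Phi) rF).
have split_at jw jw' : (jw, jw') = (Chi, Psi) \/ (jw, jw') = (Psi, Chi) ->
    (th (x, Phi)).1 = (th (w, jw)).1 -> (th (x, Psi)).1 = (th (w, jw')).1 ->
    (forall F, iso_rows e2 F -> F (th (w, jw)) (+) F (th (w, jw')) = F (c, Phi)) ->
    exists u d ku kd jx jx' jw jw', [/\ is_leaf e2 u d,
    [/\ th (x, jx) = (u, ku), th (x, jx') = (d, kd)
      & (jx, jx') = (Phi, Psi) \/ (jx, jx') = (Psi, Phi)],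
    [/\ (th (w, jw)).1 = u, (th (w, jw)).2 != Chi, (th (w, jw')).1 = d
      & (jw, jw') = (Chi, Psi) \/ (jw, jw') = (Psi, Chi)]
    & [/\ c = d, is_leaf e2 d u & (kd, ku) = (Psi, Phi) \/ (kd, ku) = (Chi, Psi)]
      \/ [/\ forall v, e2 d v = (v == c) || (v == u), c != u, c != d
           & (kd, ku) = (Chi, Phi) \/ (kd, ku) = (Psi, Psi)]].
  move=> jwE; case E1: (th (x, Phi)) => [y k1]; case E2: (th (w, jw)) => [? k2] /=.
  case E1': (th (x, Psi)) => [y' k1']; case E2': (th (w, jw')) => [? k2'] /=.
  move=> yE y'E linew'; rewrite -yE in E2 linew'; rewrite -y'E in E2' linew'.
  have yy' : y != y' by apply/eqP => yy'; apply: xsplit; rewrite E1 E1'.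
  have roles_neq j j' v k k' : th (x, j) = (v, k) -> th (w, j') = (v, k') -> k != k'.
    move=> Ej Ej'; apply: contraNneq xw => kk'; rewrite kk' -Ej' in Ej.
    by have [->] := can_inj thK Ej.
  have k12 := roles_neq _ _ _ _ _ E1 E2; have k12' := roles_neq _ _ _ _ _ E1' E2'.
  have [||u [d [ku [kd [lfu xE alt]]]]] := split_lines e2_sym e2_irr e2_deg lf2
    yy' k12 k12'.
  - by move=> F rF; rewrite -E1 -E1' linex.
  - exact: linew'.
  exists u, d, ku, kd; case: xE => -[Ey Ey' kChi].
    exists Psi, Phi, jw', jw; split=> //.
    - by rewrite E1 E1' Ey Ey'; split=> //; right.
    - move: Ey Ey'; rewrite E2 E2' /= => -[<- _] [<- _]; split=> //.
      by case: jwE => -[-> ->]; [right|left].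
  exists Phi, Psi, jw, jw'; split=> //.
  - by rewrite E1 E1' Ey Ey'; split=> //; left.
  - by move: Ey Ey'; rewrite E2 E2' /= => -[<- _] [<- _]; split.
have [[xE _ _]|[E1 E2 _]|[E1 E2 _]] := row_iso_pairing lf1.
- by case: xsplit.
- by apply: (split_at Chi Psi) => //; left.
- apply: (split_at Psi Chi) => //; first by right.
  by move=> F rF; rewrite addbC linew.
Qed.

End RowIso.

Section PathEnd.
Variables (V1 V2 : finType) (e1 : rel V1) (e2 : rel V2).
Variables (th : V1 * option bool -> V2 * option bool).
Variables (ht : V2 * option bool -> V1 * option bool).
Hypotheses (f1 : forest_rel e1) (f2 : forest_rel e2).
Hypothesis iso : row_iso e1 e2 th ht.

(** The neighbours of [d] are known; those of [c] are found by applying the same analysis to the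
    inverse isomorphism at the leaf [b]. *)
Lemma row_iso_path_end x w b c u d :
  is_leaf e1 x w -> is_leaf e2 b c ->
  th (w, Phi) = (c, Phi) -> th (x, Chi) = (b, Chi) ->
  (forall k, k != Chi -> (th (x, k)).1 = u \/ (th (x, k)).1 = d) ->
  (forall k, k != Phi -> (th (w, k)).1 = u \/ (th (w, k)).1 = d) ->
  (th (x, Phi)).1 <> (th (x, Psi)).1 ->
  is_leaf e2 u d -> (forall v, e2 d v = (v == c) || (v == u)) ->
  c != u -> c != d ->
  forall v, e2 c v = (v == b) || (v == d).
Proof.
move=> lf1 lf2 thw thx xud wud xsplit lfu nd cu cd.
have [e1_sym e1_irr e1_deg] := f1; have [e2_sym e2_irr e2_deg] := f2.
have [thK htK rows] := iso; have iso' := row_iso_sym iso.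
have ud := leaf_irr e2_irr lfu; have bc := leaf_irr e2_irr lf2.
have bu : b != u.
  by apply: contraNneq cd => bu; rewrite -lfu -bu lf2.
have bd : b != d.
  by apply: contraNneq cu => bd; rewrite eq_sym -lf2 bd nd eqxx orbT.
have xb k : k != Chi -> (th (x, k)).1 != b.
  by move=> /xud[] ->; rewrite eq_sym.
have wb k : k != Phi -> (th (w, k)).1 != b.
  by move=> /wud[] ->; rewrite eq_sym.
have htc : ht (c, Phi) = (w, Phi) by rewrite -thw thK.
have htb : ht (b, Chi) = (x, Chi) by rewrite -thx thK.
have thE k z : ht (b, k) = z -> (th z).1 = b by move=> <-; rewrite htK.
(* If the inverse did not split [b], a leaf [z] at [w] would have its [Phi] and [Psi] elements sent
   to the triple of [b]. The rows of [x] and [z] agree on [w], so parity at [u] fails: exactly one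
   of the two elements of [x] lands there. *)
have [zE|zE] := eqVneq (ht (b, Phi)).1 (ht (b, Psi)).1.
  exfalso.
  have [|[zw r1 r2]|[lfz r1 r2]] := row_iso_special_line f1 iso' (j1 := Phi)
    (j2 := Psi) (j3 := Chi) isT isT isT lf1 _ zE.
  - by rewrite htb; apply: parallel_leaf.
  - have /thE/eqP := surjective_pairing (ht (b, Phi)).
    by rewrite zw; apply/negP/wb.
  have := etrans (row_iso_parity_leaf f1 iso u lfz)
    (esym (row_iso_parity_leaf f1 iso u lf1)).
  set z := (ht (b, Phi)).1 in zE lfz.
  have zb k : k != Chi -> (th (z, k)).1 = b.
    move=> k_chi; have /thE := surjective_pairing (ht (b, Phi)).
    have /thE := surjective_pairing (ht (b, Psi)).
    have : (ht (b, Phi)).2 != (ht (b, Psi)).2.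
      apply/eqP => E; have : ht (b, Phi) = ht (b, Psi).
        by rewrite [LHS]surjective_pairing [RHS]surjective_pairing E -/z zE.
      by move/(can_inj htK).
    rewrite -zE -/z; case: (ht (b, Phi)).2 (ht (b, Psi)).2 r1 r2 => [[]|] [[]|] //;
      by case: k k_chi => [[]|].
  rewrite !zb // (negbTE bu); have := xud Phi isT; have := xud Psi isT.
  have du : (d == u) = false by rewrite eq_sym (negbTE ud).
  case=> Ep; case=> Ef; rewrite Ep Ef ?eqxx ?du /=.
  - by case: xsplit; rewrite Ep Ef.
  - by case: (_ == _); case: (_ == _).
  - by case: (_ == _); case: (_ == _).
  - by case: xsplit; rewrite Ep Ef.
have [u1 [d1 [ku1 [kd1 [jb [jb' [jc [jc' [lfu1 [ub db jbE] [uc uc_chi dc jcE] alt]]]]]]]]]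
  := row_iso_split f2 f1 iso' lf2 lf1 htc htb (elimN eqP zE).
case: alt => [[wd1 _ kE]|[nd1 wu1 wd1 kE]].
  exfalso; move: db => /thE/eqP; rewrite -wd1; apply/negP/wb.
  by case: kE => -[-> _].
have u1d1 := leaf_irr e1_irr lfu1.
have pr : parallel e2 (th (d1, Phi)) (th (u1, Chi)).
  exact: (row_iso_parallel iso (parallel_leaf lfu1)).
have neq : th (d1, Phi) != th (u1, Chi).
  by rewrite (inj_eq (can_inj thK)) xpair_eqE andbF.
have third F : iso_rows e2 F ->
    F (th (u1, Chi)) = F (b, jb) (+) F (c, jc).
  move=> rF; have ucE := surjective_pairing (ht (c, jc)); rewrite uc in ucE.
  have ku1_chi : ku1 != Chi by case: kE => -[_ ->].
  rewrite (row_iso_third iso u1 rF (k1 := ku1) (k2 := (ht (c, jc)).2)) //.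
    by rewrite -ub -ucE !htK.
  apply: contraNneq bc => kE'; move: ucE; rewrite -kE' -ub => /(can_inj htK).
  by case=> ->.
(* This column is the sum of [b] and the neighbourhood of [c], up to the entry at [c]. It is
   parallel to some [(q, Phi)]; its entry at [d] gives [q = d], so [c] has the neighbours [b] and
   [d]. *)
have row v : unit_row e2 v (th (d1, Phi)) =
    unit_row e2 v (b, jb) (+) unit_row e2 v (c, jc).
  by rewrite (parallel_unit pr) third //; apply: unit_rowP.
have {}row v : unit_row e2 v (th (d1, Phi)) =
    (b == v) (+) e2 c v (+) ((jb == Psi) (+) (jc == Psi)) && (v == c).
  rewrite row /unit_row /= lf2 (eq_sym c).
  by case: jbE => -[-> _]; case: jcE => -[-> _]; rewrite /=;
    case: (b == v); case: (e2 c v); case: (v == c).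
have rowd : unit_row e2 d (th (d1, Phi)).
  by rewrite row e2_sym nd eqxx (negbTE bd) (eq_sym d c) (negbTE cd) andbF.
have := parallel_cases e2_sym e2_irr e2_deg pr neq rowd.
case=> [[q pq]|[y [y' [yE y'E lfy lfy']]]]; last first.
  exfalso; rewrite yE /unit_row /= lfy in rowd.
  have no_leaf v : ~ is_leaf e2 d v.
    move=> lfd; have := lfd u; have := lfd c; rewrite !nd !eqxx orbT /=.
    by move=> /esym/eqP<- /esym; rewrite eq_sym (negbTE cu).
  have [yd|yd] := eqVneq y d; first by apply: (no_leaf y'); rewrite -yd.
  rewrite (negbTE yd) /= in rowd; apply: (no_leaf y).
  by rewrite (eqP rowd).
have qE v : (q == v) = (b == v) (+) e2 c v (+)
    ((jb == Psi) (+) (jc == Psi)) && (v == c).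
  by rewrite -row -(parallel_unit pq).
have qd : q = d.
  by apply/eqP; rewrite qE e2_sym nd eqxx (negbTE bd) (eq_sym d c) (negbTE cd) andbF.
move=> v; have := qE v; have := qE c.
rewrite qd e2_irr (negbTE bc) (eq_sym d c) (negbTE cd) eqxx andbT => /esym /= ->.
rewrite addbF (eq_sym d) (eq_sym b); case: (eqVneq v b) => [->|_].
  by rewrite (negbTE bd); case: (e2 c b).
by move=> ->.
Qed.

End PathEnd.

(** * Aligning an isomorphism at a leaf while keeping marked triples *)

Section MarkedIso.
Variables (V1 V2 : finType).
Implicit Types (C : pred V1) (th : V1 * option bool -> V2 * option bool).
Implicit Types ht : V2 * option bool -> V1 * option bool.

(* The vertices in [C] lost a neighbour to an earlier cut.  Fixing [phi_a] alone
   would not be enough: on a path with four vertices, two presentations may agree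
   on all the [phi]'s without being isomorphic over them. *)
Definition marked_triples C th := forall a, C a ->
  exists2 b, th (a, Phi) = (b, Phi) & forall k, (th (a, k)).1 = b.

Definition marked_iso (e1 : rel V1) (e2 : rel V2) C th :=
  exists2 g : V1 -> V2, bijective g &
  (forall a, C a -> g a = (th (a, Phi)).1) /\
  forall a b, e2 (g a) (g b) = e1 a b.

Definition marked_row_iso (e1 : rel V1) (e2 : rel V2) C th ht :=
  row_iso e1 e2 th ht /\ marked_triples C th.

Definition fixes_triple (p : V2 * option bool -> V2 * option bool) b :=
  p (b, Phi) = (b, Phi) /\ forall k, (p (b, k)).1 = b.

(** Composing with an automorphism [p] that fixes the images of marked triples does not alter the
    values prescribed on [C]. *)
Lemma marked_iso_adjust (e1 : rel V1) (e2 : rel V2) C th ht p :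
  marked_row_iso e1 e2 C th ht ->
  involutive p -> (forall F, iso_rows e2 F -> iso_rows e2 (F \o p)) ->
  (forall a b, C a -> th (a, Phi) = (b, Phi) -> (forall k, (th (a, k)).1 = b) ->
     fixes_triple p b) ->
  (marked_row_iso e1 e2 C (p \o th) (ht \o p) -> marked_iso e1 e2 C (p \o th)) ->
  marked_iso e1 e2 C th.
Proof.
move=> [[thK thK' rows] mk] pK prow pfix.
case=> [|g gbij [gC gE]]; last first.
  exists g => //; split=> // a Ca; rewrite gC //=.
  have [b thb thk] := mk a Ca; have [pb _] := pfix a b Ca thb thk.
  by rewrite thb pb.
split; first split.
- by move=> z; rewrite /= pK thK.
- by move=> z; rewrite /= thK' pK.
- move=> F; rewrite -[F \o (p \o th)]/((F \o p) \o th) -rows.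
  split=> [|rF]; first exact: prow.
  by have := prow _ rF; apply: eq_iso_rows => z; rewrite /= pK.
- move=> a Ca; have [b thb thk] := mk a Ca; have [pb pk] := pfix a b Ca thb thk.
  exists b => [|k]; first by rewrite /= thb.
  by rewrite /= [th _]surjective_pairing thk pk.
Qed.

Section Step.
Variables (e1 : rel V1) (e2 : rel V2) (C : pred V1) (x w : V1).
Hypotheses (f1 : forest_rel e1) (f2 : forest_rel e2) (lf1 : is_leaf e1 x w).
(** The state in which the edge can be cut in both graphs; each lemma below reduces a less aligned
    [th] to a case treated before. *)
Hypothesis cut_step : forall th ht b c, marked_row_iso e1 e2 C th ht ->
  is_leaf e2 b c -> (forall k, th (x, k) = (b, k)) -> th (w, Phi) = (c, Phi) ->
  (forall k, (th (w, k)).1 = c) -> marked_iso e1 e2 C th.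

Let e2_sym : symmetric e2. Proof. by case: f2. Qed.
Let e2_irr : irreflexive e2. Proof. by case: f2. Qed.
Let e2_deg : one_degenerate e2. Proof. by case: f2. Qed.
Let e1_irr : irreflexive e1. Proof. by case: f1. Qed.
Let xw : x != w. Proof. exact: (leaf_irr e1_irr lf1). Qed.

Lemma good_inj th ht : marked_row_iso e1 e2 C th ht -> injective th.
Proof. by case=> -[thK _ _] _; apply: can_inj thK. Qed.

Lemma fixes_tperm y k y' k' b : b != y -> b != y' ->
  fixes_triple (tperm (y, k) (y', k')) b.
Proof.
move=> yb y'b; have fix_b j : tperm (y, k) (y', k') (b, j) = (b, j).
  by rewrite tpermD // xpair_eqE eq_sym ?(negbTE yb) ?(negbTE y'b).
by split=> [|j]; rewrite fix_b.
Qed.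

(** Only an exchange of [Phi] and [Psi] at [b] may remain, and local complementation at [b] undoes
    it. *)
Lemma step_orient th ht b c : marked_row_iso e1 e2 C th ht ->
  is_leaf e2 b c -> th (w, Phi) = (c, Phi) -> th (x, Chi) = (b, Chi) ->
  (forall k, (th (x, k)).1 = b) -> (forall k, (th (w, k)).1 = c) ->
  marked_iso e1 e2 C th.
Proof.
move=> gd lf2 thw thx thxk thwk; have thI := good_inj gd.
have bc := leaf_irr e2_irr lf2.
have cb : (c == b) = false by rewrite eq_sym (negbTE bc).
have thx_role k : th (x, k) = (b, (th (x, k)).2).
  by rewrite {1}[th (x, k)]surjective_pairing thxk.
have [phiE|phiNE] := eqVneq (th (x, Phi)) (b, Phi).
  apply: cut_step gd lf2 _ thw thwk => -[[]|] //.
  case E: (th (x, Psi)).2 (thx_role Psi) => [[]|] // E'.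
    by have := thI _ _ (etrans E' (esym thx)).
  by have := thI _ _ (etrans E' (esym phiE)).
have phiPsi : th (x, Phi) = (b, Psi).
  case E: (th (x, Phi)).2 (thx_role Phi) phiNE => [[]|] // E'.
    by have := thI _ _ (etrans E' (esym thx)).
  by rewrite E' eqxx.
have psiPhi : th (x, Psi) = (b, Phi).
  case E: (th (x, Psi)).2 (thx_role Psi) => [[]|] // E'.
    by have := thI _ _ (etrans E' (esym thx)).
  by have := thI _ _ (etrans E' (esym phiPsi)).
apply: (marked_iso_adjust gd (leaf_complementK bc)).
- by move=> F; apply: leaf_complement_rows.
- move=> a b0 Ca thb0 thk0; have [ba|bb0] := eqVneq b0 b.
    have := row_iso_triple gd.1 thk0 (z := (x, Phi)); rewrite thxk ba => /(_ erefl) /= xa.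
    by move: thb0; rewrite -xa phiPsi.
  rewrite /fixes_triple /leaf_complement /= (negbTE bb0).
  by case: eqVneq => [->|].
move=> gd'; apply: (cut_step gd' lf2) => [[[]|]||k] /=.
- by rewrite thx /leaf_complement /= eqxx.
- by rewrite psiPhi /leaf_complement /= eqxx.
- by rewrite phiPsi /leaf_complement /= eqxx.
- by rewrite thw /leaf_complement /= eqxx cb.
- by rewrite [th _]surjective_pairing thwk /leaf_complement /= eqxx cb.
Qed.

(** The images of [(w, Chi)] and [(w, Psi)] lie at [c] or at another leaf [y] of [c]; in the latter
    case the pivot on [yc] moves them to [c]. *)
Lemma step_hub_line th ht b c : marked_row_iso e1 e2 C th ht ->
  is_leaf e2 b c -> th (w, Phi) = (c, Phi) -> th (x, Chi) = (b, Chi) ->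
  (forall k, (th (x, k)).1 = b) -> (th (w, Chi)).1 = (th (w, Psi)).1 ->
  marked_iso e1 e2 C th.
Proof.
move=> gd lf2 thw thx thxk thwk; have thI := good_inj gd.
have bc := leaf_irr e2_irr lf2.
have [|[yc _ _]|[lfy r1 r2]] :=
  row_iso_special_line f2 gd.1 (j1 := Chi) (j2 := Psi) (j3 := Phi)
    isT isT isT lf2 _ thwk.
- by rewrite thw.
- apply: (step_orient gd lf2) => // -[[]|] //; first by rewrite -thwk.
  by rewrite thw.
set y := (th (w, Chi)).1 in thwk lfy *.
have yc := leaf_irr e2_irr lfy.
have cy : (c == y) = false by rewrite eq_sym (negbTE yc).
have yb : y != b.
  apply: contraNneq xw => yb; apply/eqP/esym.
  exact: (row_iso_triple gd.1 thxk (z := (w, Chi)) yb).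
have p_off z k : z != y -> z != c -> leaf_pivot y c (z, k) = (z, k).
  by move=> zy zc; rewrite /leaf_pivot /= (negbTE zy) (negbTE zc).
apply: (marked_iso_adjust gd (leaf_pivotK yc)).
- by move=> F; apply: leaf_pivot_rows.
(* A marked triple is sent into a single triple, whereas [w] has images at both [y] and [c]; so
   neither is the image of a marked one. Similar arguments recur below. *)
- move=> a b0 Ca thb0 thk0.
  have b0y : b0 != y.
    apply: contraNneq yc => b0y.
    have wa := row_iso_triple gd.1 thk0 (z := (w, Chi)) (esym b0y).
    by move: thb0; rewrite -wa thw b0y => -[->].
  have b0c : b0 != c.
    apply: contraNneq yc => b0c.
    have wa : w = a.
      by apply: (row_iso_triple gd.1 thk0 (z := (w, Phi))); rewrite thw b0c.
    by rewrite /y wa thk0 b0c.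
  by split=> [|k]; rewrite p_off.
move=> gd'; apply: (step_orient gd' lf2) => [|||[[]|]] /=.
- by rewrite thw /leaf_pivot /= cy eqxx.
- by rewrite thx p_off // eq_sym.
- by move=> k; rewrite [th _]surjective_pairing thxk p_off // eq_sym.
- rewrite [th _]surjective_pairing -/y /leaf_pivot /= eqxx.
  by case: (th (w, Chi)).2 r1 => [[]|].
- rewrite [th _]surjective_pairing -thwk /leaf_pivot /= eqxx.
  by case: (th (w, Psi)).2 r2 => [[]|].
- by rewrite thw /leaf_pivot /= cy eqxx.
Qed.

(** The two elements of [x] reach [c] or a leaf [y] at [c]. From [c] the pivot on [bc] brings them
    to [b]; at [y] the parallel elements [(b, Chi)] and [(y, Chi)] are swapped and [y] takes the
    place of [b]. *)
Lemma step_same_line th ht b c : marked_row_iso e1 e2 C th ht ->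
  is_leaf e2 b c -> th (w, Phi) = (c, Phi) -> th (x, Chi) = (b, Chi) ->
  (th (x, Phi)).1 = (th (x, Psi)).1 -> marked_iso e1 e2 C th.
Proof.
move=> gd lf2 thw thx xline; have thI := good_inj gd.
have bc := leaf_irr e2_irr lf2.
have cb : (c == b) = false by rewrite eq_sym (negbTE bc).
have [wline xy_wy] : (th (w, Chi)).1 = (th (w, Psi)).1 /\
    (th (x, Phi)).1 != (th (w, Chi)).1.
  have [[_ ? ?] //|[_ _]|[_ _]] := row_iso_pairing f1 gd.1 lf1;
  by rewrite xline eqxx.
have [|[yc r1 r2]|[lfy r1 r2]] :=
    row_iso_special_line f2 gd.1 (j1 := Phi) (j2 := Psi) (j3 := Chi)
      isT isT isT lf2 _ xline.
- by rewrite thx; apply: parallel_leaf.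
- have [lfz s1 s2] : [/\ is_leaf e2 (th (w, Chi)).1 c,
      (th (w, Chi)).2 != Chi & (th (w, Psi)).2 != Chi].
    have [|[zc _ _]|//] := row_iso_special_line f2 gd.1 (j1 := Chi)
      (j2 := Psi) (j3 := Phi) isT isT isT lf2 _ wline; first by rewrite thw.
    by rewrite yc zc eqxx in xy_wy.
  set z := (th (w, Chi)).1 in wline xy_wy lfz.
  have zc := leaf_irr e2_irr lfz.
  have pz k : k != Chi -> leaf_pivot b c (z, k) =
      if z == b then (c, if k is Phi then Chi else Psi) else (z, k).
    by rewrite /leaf_pivot /= (negbTE zc); case: k => [[]|] // _; case: (z == b).
  have pc k : k != Phi -> (leaf_pivot b c (c, k)).1 = b.
    by rewrite /leaf_pivot /= cb eqxx; case: k => [[]|].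
  apply: (marked_iso_adjust gd (leaf_pivotK bc)).
  + by move=> F; apply: leaf_pivot_rows.
  + move=> a b0 Ca thb0 thk0.
    have b0b : b0 != b.
      apply: contraNneq bc => b0b.
      have xa : x = a.
        by apply: (row_iso_triple gd.1 thk0 (z := (x, Chi))); rewrite thx b0b.
      by rewrite -b0b -(thk0 Phi) -xa yc.
    have b0c : b0 != c.
      apply: contraNneq r1 => b0c.
      have xa : x = a.
        by apply: (row_iso_triple gd.1 thk0 (z := (x, Phi))); rewrite yc b0c.
      by rewrite xa thb0.
    have p_off k : leaf_pivot b c (b0, k) = (b0, k).
      by rewrite /leaf_pivot /= (negbTE b0b) (negbTE b0c).
    by split=> [|k]; rewrite p_off.
  move=> gd'; apply: (step_hub_line gd' lf2) => /= [|||].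
  + by rewrite thw /leaf_pivot /= cb eqxx.
  + by rewrite thx /leaf_pivot /= eqxx.
  + move=> [[]|].
    * by rewrite thx /leaf_pivot /= eqxx.
    * by rewrite [th _]surjective_pairing -xline yc pc.
    * by rewrite [th _]surjective_pairing yc pc.
  + rewrite [th (w, Chi)]surjective_pairing -/z [th (w, Psi)]surjective_pairing.
    by rewrite -wline !pz //; case: (z == b).
set y := (th (x, Phi)).1 in xline xy_wy lfy.
have [yb|yb] := eqVneq y b.
  apply: (step_hub_line gd lf2) => // -[[]|]; rewrite -?xline //.
  by rewrite thx.
have by' : b != y by rewrite eq_sym.
have pr : parallel e2 (b, Chi) (y, Chi).
  by move=> F rF; rewrite -(parallel_leaf lf2 rF) (parallel_leaf lfy rF).
have p_off z : z != th (x, Chi) -> z != (y, Chi) ->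
    tperm (b, Chi) (y, Chi) z = z.
  by rewrite thx => zb zy; rewrite tpermD // eq_sym.
apply: (marked_iso_adjust gd (tpermK (b, Chi) (y, Chi))).
- by move=> F; apply: parallel_swap_rows.
- move=> a b0 Ca thb0 thk0; apply: fixes_tperm.
    apply: contraNneq by' => b0b.
    have xa : x = a.
      by apply: (row_iso_triple gd.1 thk0 (z := (x, Chi))); rewrite thx b0b.
    by rewrite -b0b /y xa thb0.
  apply: contraNneq yb => b0y.
  have xa : x = a by apply: (row_iso_triple gd.1 thk0 (z := (x, Phi))).
  by rewrite -b0y -(thk0 Chi) -xa thx.
move=> gd'; apply: (step_hub_line gd' lfy) => /= [|||].
- by rewrite thw tpermD // xpair_eqE andbF.
- by rewrite thx tpermL.
- move=> [[]|]; first by rewrite thx tpermL.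
    rewrite p_off ?(inj_eq thI) ?xpair_eqE ?andbF //.
    by apply: contraNneq r2 => ->.
  rewrite p_off ?(inj_eq thI) ?xpair_eqE ?andbF //.
  by apply: contraNneq r1 => ->.
- rewrite !p_off ?(inj_eq thI) ?xpair_eqE ?(eq_sym w) ?(negbTE xw) //.
    by apply: contraNneq xy_wy; rewrite wline => ->.
  by apply: contraNneq xy_wy => ->.
Qed.

(** Swapping the parallel elements [(b, Psi)] and [(c, Psi)] of an edge component, or applying
    [path_swap] on a path with four vertices, brings the two elements of [x] into one triple. *)
Lemma step_split_line th ht b c : marked_row_iso e1 e2 C th ht ->
  is_leaf e2 b c -> th (w, Phi) = (c, Phi) -> th (x, Chi) = (b, Chi) ->
  (th (x, Phi)).1 <> (th (x, Psi)).1 -> marked_iso e1 e2 C th.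
Proof.
move=> gd lf2 thw thx xsplit; have bc := leaf_irr e2_irr lf2.
have [u [d [ku [kd [jx [jx' [jw [jw' [lfu [xu xd jxE] [wu _ wd jwE] alt]]]]]]]]]
  := row_iso_split f1 f2 gd.1 lf1 lf2 thw thx xsplit.
have ud := leaf_irr e2_irr lfu.
have same_line p : (p (u, ku)).1 = (p (d, kd)).1 ->
    ((p \o th) (x, Phi)).1 = ((p \o th) (x, Psi)).1.
  by case: jxE xu xd => -[-> ->] xu xd /=; rewrite xu xd.
case: alt => [[cd lfd kE]|[nd cu cd kE]].
  have bu : b = u by apply/eqP; rewrite -lfd -cd e2_sym lf2.
  rewrite -{}cd -{}bu in lfd xu xd wu wd same_line ud {lfu}.
  have pr : parallel e2 (b, Psi) (c, Psi).
    move=> F rF; have [_ ->] := rF b; have [_ ->] := rF c.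
    by rewrite -(parallel_leaf lf2 rF) -(parallel_leaf lfd rF) addbC.
  apply: (marked_iso_adjust gd (tpermK (b, Psi) (c, Psi))).
  - by move=> F; apply: parallel_swap_rows.
  - move=> a b0 Ca thb0 thk0; apply: fixes_tperm; apply: contraNneq bc => b0E.
      have xa : x = a.
        by apply: (row_iso_triple gd.1 thk0 (z := (x, Chi))); rewrite thx b0E.
      by rewrite -b0E -(thk0 jx') -xa xd.
    have wa : w = a.
      by apply: (row_iso_triple gd.1 thk0 (z := (w, Phi))); rewrite thw b0E.
    by rewrite -b0E -(thk0 jw) -wa wu.
  move=> gd'; apply: (step_same_line gd' lf2).
  - by rewrite /= thw tpermD // xpair_eqE andbF.
  - by rewrite /= thx tpermD // xpair_eqE andbF.
  apply: same_line; case: kE => -[-> ->].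
    by rewrite tpermR tpermD // xpair_eqE andbF.
  by rewrite tpermL tpermD // xpair_eqE andbF.
have bu : b != u by apply: contraNneq cd => bu; rewrite -lfu -bu lf2.
have bd : b != d.
  by apply: contraNneq cu => bd; rewrite eq_sym -lf2 bd nd eqxx orbT.
have unq : uniq [:: b; c; d; u].
  by rewrite /= !inE !negb_or bc bd bu cd cu (eq_sym d) ud.
have xud k : k != Chi -> (th (x, k)).1 = u \/ (th (x, k)).1 = d.
  by case: jxE xu xd => -[-> ->] Eu Ed; case: k => [[]|] // _;
    rewrite ?Eu ?Ed; [right|left|left|right].
have wud k : k != Phi -> (th (w, k)).1 = u \/ (th (w, k)).1 = d.
  by case: jwE wu wd => -[-> ->] Eu Ed; case: k => [[]|] // _; [left|right|right|left].
have nc := row_iso_path_end f1 f2 gd.1 lf1 lf2 thw thx xud wud xsplit lfu nd cu cd.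
apply: (marked_iso_adjust gd (path_swapK unq)).
- by move=> F; apply: path_swap_rows.
- move=> a b0 Ca thb0 thk0.
  have b0b : b0 != b.
    apply: contraNneq bu => b0E; have xa : x = a.
      by apply: (row_iso_triple gd.1 thk0 (z := (x, Chi))); rewrite thx b0E.
    by rewrite -b0E -(thk0 jx) -xa xu.
  have b0c : b0 != c.
    apply: contraNneq cu => b0E; have wa : w = a.
      by apply: (row_iso_triple gd.1 thk0 (z := (w, Phi))); rewrite thw b0E.
    by rewrite -b0E -(thk0 jw) -wa wu.
  have b0u : b0 != u.
    apply: contraNneq ud => b0E; have xa : x = a.
      by apply: (row_iso_triple gd.1 thk0 (z := (x, jx))); rewrite xu b0E.
    by rewrite -b0E -(thk0 jx') -xa xd.
  have b0d : b0 != d.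
    apply: contraNneq ud => b0E; have xa : x = a.
      by apply: (row_iso_triple gd.1 thk0 (z := (x, jx'))); rewrite xd b0E.
    by rewrite eq_sym -b0E -(thk0 jx) -xa xu.
  have p_off k : path_swap b c d u (b0, k) = (b0, k).
    by rewrite /path_swap /= (negbTE b0b) (negbTE b0c) (negbTE b0d) (negbTE b0u).
  by split=> [|k]; rewrite p_off.
have cb : (c == b) = false by rewrite eq_sym (negbTE bc).
have db : (d == b) = false by rewrite eq_sym (negbTE bd).
have dc : (d == c) = false by rewrite eq_sym (negbTE cd).
have ub : (u == b) = false by rewrite eq_sym (negbTE bu).
have uc : (u == c) = false by rewrite eq_sym (negbTE cu).
move=> gd'; apply: (step_same_line gd' lf2).
- by rewrite /= thw /path_swap /= cb eqxx.
- by rewrite /= thx /path_swap /= eqxx.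
apply: same_line; rewrite /path_swap /= ub uc db dc eqxx (negbTE ud) eqxx.
by case: kE => -[-> ->].
Qed.

Lemma step_aligned th ht c : marked_row_iso e1 e2 C th ht ->
  th (w, Phi) = (c, Phi) -> marked_iso e1 e2 C th.
Proof.
move=> gd thw; have thI := good_inj gd; have [thK htK rows] := gd.1.
have pr : parallel e2 (c, Phi) (th (x, Chi)).
  by rewrite -thw; apply: (row_iso_parallel gd.1 (parallel_leaf lf1)).
case E: (th (x, Chi)) => [b k]; rewrite E in pr.
case: (parallel_PhiP e2_irr pr) => [[bc kE]|[lf2 kE]|[bc kE c_iso]]; subst k.
- by rewrite bc -thw in E; have := thI _ _ E.
- have [xE|/eqP xE] := eqVneq (th (x, Phi)).1 (th (x, Psi)).1.
    exact: (step_same_line gd lf2 thw E).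
  exact: (step_split_line gd lf2 thw E).
(* The row of an isolated [c] is formed by [(c, Phi)] and [(c, Psi)]. Pulled back, it would meet the
   triple of [w] in [(w, Phi)] alone. *)
exfalso; have /rows/(_ w)[_] := unit_rowP e2 c.
have unitE z : unit_row e2 c z -> z = (c, Phi) \/ z = (c, Psi).
  case: z => v j; rewrite /unit_row /= e2_sym c_iso.
  by case: j => [[]|] //=; rewrite ?addbF => /eqP->; [right|left].
have offc j : j != Phi -> unit_row e2 c (th (w, j)) = false.
  move=> j0; apply/negP => /unitE[].
    by rewrite -thw => /thI[jE]; rewrite jE in j0.
  by rewrite -bc -E => /thI[wx _]; have := xw; rewrite wx eqxx.
by rewrite /= (offc Chi) // (offc Psi) // thw /unit_row /= eqxx.
Qed.

(** Parallel elements can be transposed; marked triples are not disturbed because distinct [Phi]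
    elements are never parallel. *)
Lemma step_parallel th ht c : marked_row_iso e1 e2 C th ht ->
  parallel e2 (c, Phi) (th (w, Phi)) -> marked_iso e1 e2 C th.
Proof.
move=> gd pr; have [thK htK rows] := gd.1.
case E: (th (w, Phi)) => [y k]; rewrite E in pr.
have [[yc kE]|ykc] := eqVneq (y, k) (c, Phi).
  by apply: (step_aligned gd (c := c)); rewrite E yc kE.
have par_w a : th (a, Phi) = (c, Phi) -> a = w.
  move=> tha; apply: (@parallel_Phi_inj _ e1).
  have := row_iso_parallel (row_iso_sym gd.1) pr.
  by rewrite -tha -E !thK.
apply: (marked_iso_adjust gd (tpermK (c, Phi) (y, k))).
- by move=> F; apply: parallel_swap_rows.
- move=> a b0 Ca thb0 thk0; apply: fixes_tperm.
    apply: contraNneq ykc => b0c; rewrite b0c in thb0.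
    by rewrite -E -(par_w _ thb0) thb0.
  apply: contraNneq ykc => b0y.
  have wa : w = a.
    by apply: (row_iso_triple gd.1 thk0 (z := (w, Phi))); rewrite E b0y.
  rewrite -wa E in thb0; rewrite thb0 in pr *.
  by rewrite (parallel_Phi_inj pr).
by move=> gd'; apply: (step_aligned gd' (c := c)); rewrite /= E tpermR.
Qed.

(** The image of [(w, Phi)] has a parallel partner. If it is not parallel to a [Phi] element, it is
    a [Psi] element of an edge component, and local complementation makes it a [Phi] element. *)
Lemma leaf_step th ht : marked_row_iso e1 e2 C th ht -> marked_iso e1 e2 C th.
Proof.
move=> gd; have thI := good_inj gd; have [thK htK rows] := gd.1.
have pr : parallel e2 (th (w, Phi)) (th (x, Chi)).
  exact: (row_iso_parallel gd.1 (parallel_leaf lf1)).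
have neq : th (w, Phi) != th (x, Chi).
  by rewrite (inj_eq thI) xpair_eqE andbF.
have [d dw] : exists d, unit_row e2 d (th (w, Phi)).
  have r : iso_rows e2 (unit_row e1 w \o ht).
    by apply/rows; apply: eq_iso_rows (unit_rowP e1 w) => z /=; rewrite thK.
  by apply: (unit_row_nonzero e2_irr r); rewrite /= thK /unit_row eqxx.
have := parallel_cases e2_sym e2_irr e2_deg pr neq dw.
case=> [[c pc]|[y [y' [yE y'E lfy lfy']]]]; first exact: step_parallel gd pc.
have yy' := leaf_irr e2_irr lfy.
have y'y : (y' == y) = false by rewrite eq_sym (negbTE yy').
apply: (marked_iso_adjust gd (leaf_complementK yy')).
- by move=> F; apply: leaf_complement_rows.
- move=> a b0 Ca thb0 thk0; have [b0y|b0y] := eqVneq b0 y.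
    have wa : w = a.
      by apply: (row_iso_triple gd.1 thk0 (z := (w, Phi))); rewrite yE b0y.
    by move: thb0; rewrite -wa yE.
  rewrite /fixes_triple /leaf_complement /= (negbTE b0y).
  by case: eqVneq => [->|].
move=> gd'; apply: (step_aligned gd' (c := y)).
by rewrite /= yE /leaf_complement /= eqxx.
Qed.

End Step.
Lemma forest_rel_cut (V : finType) (e : rel V) x w :
  forest_rel e -> forest_rel (cut e x w).
Proof.
case=> e_sym e_irr e_deg; split; [exact: cut_sym|exact: cut_irr|].
exact: one_degenerate_sub e_deg _ (@cut_sub _ _ _ _).
Qed.

(** By [iso_rows_cut] the old row spaces determine the new ones, and an aligned [th] respects this.
    Marking [x] and [w] ensures that the isomorphism obtained sends the removed edge to the removed
    edge. *)
Lemma cut_both (e1 : rel V1) (e2 : rel V2) C th ht x w b c :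
  forest_rel e1 -> forest_rel e2 -> is_leaf e1 x w -> is_leaf e2 b c ->
  marked_row_iso e1 e2 C th ht -> (forall k, th (x, k) = (b, k)) ->
  th (w, Phi) = (c, Phi) -> (forall k, (th (w, k)).1 = c) ->
  (marked_row_iso (cut e1 x w) (cut e2 b c) [pred a | [|| a == x, a == w | C a]] th ht ->
   marked_iso (cut e1 x w) (cut e2 b c) [pred a | [|| a == x, a == w | C a]] th) ->
  marked_iso e1 e2 C th.
Proof.
move=> [e1_sym e1_irr _] [e2_sym e2_irr _] lf1 lf2 [[thK htK rows] mk] thx thw thwk.
have thxb z : ((th z).1 == b) = (z.1 == x).
  apply/eqP/eqP => [zb|]; last by case: z => y k /= ->; rewrite thx.
  case E: (th z) zb => [? k] /= bE; rewrite bE -(thx k) in E.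
  by rewrite (can_inj thK E).
case=> [|g gbij [gC gE]].
  split; first split=> // F.
    rewrite (iso_rows_cut F e2_sym e2_irr lf2) (iso_rows_cut _ e1_sym e1_irr lf1).
    rewrite /= !thx; split=> -[FC FP rF]; split=> //.
      move/rows: rF; apply: eq_iso_rows => z.
      rewrite /contract_leaf /= thxb thw; case: eqP => // zx.
      by case: z zx => y k /= ->; rewrite thx.
    apply/rows; move: rF; apply: eq_iso_rows => z.
    rewrite /contract_leaf /= thxb thw; case: eqP => // zx.
    by case: z zx => y k /= ->; rewrite thx.
  move=> a /or3P[/eqP->|/eqP->|/mk//].
    by exists b => [|k]; rewrite thx.
  by exists c.
have gI := bij_inj gbij.
have gx : g x = b by rewrite gC ?thx //= eqxx.
have gw : g w = c by rewrite gC ?thw //= eqxx orbT.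
exists g => //; split=> [a Ca|a a']; first by rewrite gC //= Ca !orbT.
have gx' y : (g y == b) = (y == x) by rewrite -gx (inj_eq gI).
have gw' y : (g y == c) = (y == w) by rewrite -gw (inj_eq gI).
have [->|ax] := eqVneq a x; first by rewrite gx lf2 lf1 gw'.
have [->|a'x] := eqVneq a' x; first by rewrite gx e2_sym e1_sym lf2 lf1 gw'.
have := gE a a'; rewrite (cut_leafE e1_sym _ _ lf1) (cut_leafE e2_sym _ _ lf2).
by rewrite !gx' ax a'x !andbT.
Qed.

(** Here [(a, Phi)] and [(a, Psi)] form a row, so their images share a triple, which defines [g]. A
    leaf [y] at [c] in [e2] would make [(c, Phi)] and [(y, Chi)] the images of such a pair, although
    they lie in different triples. *)
Lemma edgeless_iso (e1 : rel V1) (e2 : rel V2) C th ht :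
  forest_rel e1 -> forest_rel e2 -> marked_row_iso e1 e2 C th ht ->
  (forall a b, e1 a b = false) -> marked_iso e1 e2 C th.
Proof.
move=> f1 f2 gd e1F; have [thK htK rows] := gd.1.
have [e1_sym e1_irr e1_deg] := f1; have [e2_sym e2_irr e2_deg] := f2.
have same_triple a : (th (a, Phi)).1 = (th (a, Psi)).1.
  have := row_iso_parity gd.1 (S := [:: (a, Phi); (a, Psi)]).
  have r : iso_rows e1
      (fun z => \big[addb/false]_(s <- [:: (a, Phi); (a, Psi)]) (z == s)).
    apply: eq_iso_rows (unit_rowP e1 a) => -[v k].
    rewrite !big_cons big_nil /unit_row /= !xpair_eqE e1F !addbF.
    by case: k => [[]|]; rewrite /= ?andbF ?andbT ?addbF.
  move=> /(_ r (th (a, Phi)).1); rewrite !big_cons big_nil eqxx addbF.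
  by move=> /negbFE/eqP.
have e2F b c : e2 b c = false.
  apply/negP => e2bc.
  have [{b c e2bc}y [c lf]] := one_degenerate_leaf e2_sym e2_deg e2bc.
  have pr := row_iso_parallel (row_iso_sym gd.1) (parallel_leaf lf).
  have neq : ht (c, Phi) != ht (y, Chi).
    by rewrite (inj_eq (can_inj htK)) xpair_eqE andbF.
  have [d dc] : exists d, unit_row e1 d (ht (c, Phi)).
    have /rows r := unit_rowP e2 c.
    by apply: (unit_row_nonzero e1_irr r); rewrite /= htK /unit_row /= eqxx.
  have [[q pq]|[v [v' [_ _ lfv _]]]] := parallel_cases e1_sym e1_irr e1_deg pr neq dc;
    last by have := lfv v'; rewrite e1F eqxx.
  have in_q z : parallel e1 (q, Phi) z -> z = (q, Phi) \/ z = (q, Psi).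
    case: z => v k /(parallel_PhiP e1_irr)[[-> ->]|[lfv _]|[-> -> _]]; [by left| |by right].
    by have := lfv q; rewrite e1F eqxx.
  have pq' : parallel e1 (q, Phi) (ht (y, Chi)) by move=> F rF; rewrite (pq F rF) pr.
  have yc : y = c.
    have := same_triple q; move: neq.
    case: (in_q _ pq) (in_q _ pq') => <- [] E; rewrite ?E ?eqxx //= => _.
      by rewrite -E !htK.
    by rewrite -E !htK.
  by have := leaf_irr e2_irr lf; rewrite yc eqxx.
pose g a := (th (a, Phi)).1.
have gI : injective g.
  move=> a a' gaa'; apply/eqP; apply: contraT => aa'.
  suff : 4 <= 3 by [].
  apply: (row_iso_no_four gd.1 (zs := [:: (a, Phi); (a, Psi); (a', Phi); (a', Psi)])
    (v := g a)).
    by rewrite /= !inE !xpair_eqE /= (negbTE aa') !andbF.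
  by rewrite /= -!same_triple -/(g a) -/(g a') -gaa' eqxx.
have card_le : #|V2| <= #|V1|.
  have /bij_eq_card : bijective th by exists ht.
  by rewrite !card_prod card_option card_bool => /eqP; rewrite eqn_pmul2r // => /eqP->.
exists g; first exact: inj_card_bij.
by split=> // a b; rewrite e1F e2F.
Qed.

Theorem isotropic_rows_unique (e1 : rel V1) (e2 : rel V2) C th ht :
  forest_rel e1 -> forest_rel e2 -> marked_row_iso e1 e2 C th ht -> marked_iso e1 e2 C th.
Proof.
move: {2}_.+1 (ltnSn #|[set p : V1 * V1 | e1 p.1 p.2]|) => n.
elim: n => [//|n IHn] in e1 e2 C th ht *; rewrite ltnS => le_n f1 f2 gd.
have [/existsP[a /existsP[a' eaa']]|/existsPn none] :=
    boolP [exists a, exists b, e1 a b]; last first.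
  apply: (edgeless_iso f1 f2 gd) => a b.
  by have /existsPn/(_ b)/negbTE := none a.
have [x [w lf1]] : exists x w, is_leaf e1 x w.
  by case: (f1) => e1_sym _ e1_deg; apply: one_degenerate_leaf eaa'.
apply: (leaf_step f1 f2 lf1 _ gd) => {}th {}ht b c {}gd lf2 thx thw thwk.
apply: (cut_both f1 f2 lf1 lf2 gd thx thw thwk); apply: IHn.
- by apply: leq_trans le_n; apply: card_cut; rewrite lf1.
- exact: forest_rel_cut.
- exact: forest_rel_cut.
Qed.

End MarkedIso.

(** * Matroid isomorphisms and row spaces *)

Lemma F2_addrr (a : 'F_2) : (a + a = 0)%R.
Proof. by rewrite -mulr2n -mulr_natl pchar_Zp // mul0r. Qed.

Lemma F2_cases (a : 'F_2) : a = 0%R \/ a = 1%R.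
Proof.
by case: a => [[|[|//]] lt2]; [left|right]; apply: val_inj.
Qed.

Lemma F2_natr_addb (a b : bool) : ((a (+) b)%:R = a%:R + b%:R :> 'F_2)%R.
Proof. by case: a; case: b; rewrite /= ?addr0 ?add0r ?F2_addrr. Qed.

Lemma F2_natr_xor (I : Type) (r : seq I) (P : pred I) (F : I -> bool) :
  ((\big[addb/false]_(i <- r | P i) F i)%:R =
   \sum_(i <- r | P i) (F i)%:R :> 'F_2)%R.
Proof. exact: (big_morph (fun b : bool => (b%:R : 'F_2)%R) F2_natr_addb). Qed.

Section ZeroSums.
Variables (m n : nat) (B : 'M['F_2]_(m, n)).
Implicit Types (S T C : {set 'I_n}).

Definition zero_sum T := (\sum_(j in T) col j B == 0)%R.

Lemma col_addrr j : (col j B + col j B = 0)%R.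
Proof. by apply/matrixP => i k; rewrite !mxE F2_addrr. Qed.

Lemma span_cols_sum (s : seq 'I_n) v : uniq s ->
  v \in <<[seq col j B | j <- s]>>%VS ->
  exists2 T : {set 'I_n}, {subset T <= s} & v = (\sum_(j in T) col j B)%R.
Proof.
elim: s v => [|x s IHs] v /=.
  rewrite span_nil memv0 => _ /eqP->; exists set0; last by rewrite big_set0.
  by move=> j; rewrite inE.
case/andP=> xs unq; rewrite span_cons => /memv_addP[u /vlineP[k ->]].
move=> [u' /(IHs _ unq)[T Ts ->] ->].
case: (F2_cases k) => ->; [exists T | exists (x |: T)].
- by move=> j /Ts; rewrite inE orbC => ->.
- by rewrite scale0r add0r.
- by move=> j; rewrite in_setU1 inE => /orP[->//|/Ts->]; rewrite orbT.
- by rewrite scale1r big_setU1 //; apply: contra xs => /Ts.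
Qed.

(** Over GF(2) a linear relation is nothing but a set of columns with zero sum. *)
Lemma dependentP S : reflect
  (exists T : {set 'I_n}, [/\ T \subset S, T != set0 & zero_sum T])
  (@dependent (binary_matroid B) S).
Proof.
apply: (iffP idP) => [|[T [TS T0 zT]]]; last first.
  apply/negP => /(cols_freeS TS); have [x xT] := set0Pn _ T0.
  rewrite -(setD1K xT) cols_freeU1 ?setD11 // => /andP[xspan _].
  case/negP: xspan.
  have -> : col x B = (\sum_(j in T :\ x) col j B)%R.
    apply/eqP; move/eqP: zT; rewrite (big_setD1 x) //= => /(congr1 (+%R (col x B))).
    by rewrite addrA col_addrr add0r addr0 => ->.
  apply: memv_suml => j jT; apply: memv_span; apply: map_f.
  by rewrite mem_enum.
rewrite /dependent /=; elim: {S}#|S| {-2}S (erefl #|S|) => [|k IHk] S cardS.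
  by rewrite (cards0_eq cardS) cols_free0.
have [x xS] : exists x, x \in S by apply/set0Pn; rewrite -card_gt0 cardS.
rewrite -(setD1K xS) cols_freeU1 ?setD11 // negb_and negbK => /orP[xspan|].
  have [T TS xE] := span_cols_sum (enum_uniq _) xspan.
  have xT : x \notin T by apply/negP => /TS; rewrite mem_enum setD11.
  exists (x |: T); split.
  - apply: setUS; apply/subsetP => j /TS; rewrite mem_enum //.
  - by apply/set0Pn; exists x; rewrite setU11.
  - by rewrite /zero_sum big_setU1 //= -xE col_addrr.
case/IHk; first by move: cardS; rewrite (cardsD1 x) xS => -[].
move=> T [TS T0 zT]; exists T; split=> //.
exact: subset_trans TS (subsetUr _ _).
Qed.

Lemma zero_sum_dependent T : T != set0 -> zero_sum T ->
  @dependent (binary_matroid B) T.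
Proof. by move=> T0 zT; apply/dependentP; exists T. Qed.

Lemma circuit_zero_sum T :
  minset (fun S => @dependent (binary_matroid B) S) T -> zero_sum T.
Proof.
case/minsetP=> /dependentP[U [UT U0 zU]] minT.
by rewrite -(minT U) // zero_sum_dependent.
Qed.

Lemma zero_sum_setD C T : C \subset T -> zero_sum C -> zero_sum T = zero_sum (T :\: C).
Proof.
move=> CT /eqP zC; rewrite /zero_sum (big_setID C) /= (setIidPr CT) zC.
by rewrite add0r.
Qed.

End ZeroSums.

(** A nonempty zero-sum set contains a circuit, which sums to zero and is mapped to a circuit;
    induction handles what is left after removing it. *)
Lemma matroid_iso_zero_sum m n m' n' (B : 'M['F_2]_(m, n)) (B' : 'M['F_2]_(m', n'))
    (f : 'I_n -> 'I_n') T : bijective f ->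
  (forall S : {set 'I_n}, @dependent (binary_matroid B') (f @: S) =
                          @dependent (binary_matroid B) S) ->
  zero_sum B T -> zero_sum B' (f @: T).
Proof.
move=> [f' fK f'K] fdep; have fI := can_inj fK.
elim: {T}_.+1 {-2}T (ltnSn #|T|) => // k IHk T; rewrite ltnS => le_k zT.
have [->|T0] := eqVneq T set0; first by rewrite imset0 /zero_sum big_set0.
have [C minC CT] := minset_exists (P := fun S => @dependent (binary_matroid B) S)
  (zero_sum_dependent T0 zT).
have zC := circuit_zero_sum minC; have [depC minCP] := minsetP minC.
have C0 : C != set0.
  by apply: contraTneq depC => ->; rewrite /dependent /= negbK cols_free0.
have zfC : zero_sum B' (f @: C).
  apply: circuit_zero_sum; apply/minsetP; split; first by rewrite fdep.
  move=> D depD DC; have DE : D = f @: (f' @: D).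
    by rewrite -imset_comp (eq_imset (g := id)) ?imset_id.
  rewrite DE (minCP (f' @: D)) //; first by rewrite -fdep -DE.
  apply/subsetP => j /imsetP[d dD ->].
  by have /imsetP[i iC ->] := subsetP DC d dD; rewrite fK.
rewrite (zero_sum_setD (imsetS f CT) zfC).
have -> : f @: T :\: f @: C = f @: (T :\: C).
  by apply/setP => j; rewrite -(f'K j) !inE !mem_imset // !inE.
apply: IHk; last by rewrite -(zero_sum_setD CT zC).
apply: leq_trans le_k; rewrite -(cardsID C T) (setIidPr CT) -addn1 addnC leq_add2r.
by rewrite card_gt0.
Qed.

Section LabelledMatrix.
Variables (V K : finType) (M : V -> K -> bool) (p : V -> K).

Definition labelled m n (B : 'M['F_2]_(m, n)) (r : V -> 'I_m) (t : K -> 'I_n) :=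
  [/\ bijective r, bijective t & forall u k, B (r u) (t k) = (M u k)%:R%R].

Hypothesis Mp : forall u v, M u (p v) = (u == v).

Definition kernel_set (T : {set K}) :=
  forall u, \big[addb/false]_(k in T) M u k = false.

Definition row_function (F : K -> bool) :=
  forall T, kernel_set T -> \big[addb/false]_(k in T) F k = false.

(** The row space is the orthogonal complement of the kernel. Thanks to the identity block selected
    by [p], it is enough to test [F] on the fundamental circuit of each [k], formed by [k] and the
    [p u] with [M u k]. *)
Lemma row_functionP F :
  row_function F <-> forall k, F k = \xor_(u | predT u) (M u k && F (p u)).
Proof.
have xor_at v (G : V -> bool) : \xor_(u | predT u) ((u == v) && G u) = G v.
  rewrite (bigD1 v) //= eqxx /= big1 ?addbF // => u; case: eqP => //.
split=> [rF k|FE T kerT]; last first.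
  rewrite (eq_bigr (fun k => \xor_(u | predT u) (M u k && F (p u)))) //.
  rewrite exchange_big big1 //= => u _.
  by rewrite -big_distrl /= kerT.
have [/existsP[v /eqP->]|/existsPn kp] := boolP [exists v, k == p v].
  under eq_bigr do rewrite Mp.
  by rewrite xor_at.
pose T := k |: [set p u | u in V & M u k].
have pI : injective p.
  by move=> u v uv; have := Mp u v; rewrite -uv Mp eqxx => /esym/eqP.
have kT : k \notin [set p u | u in V & M u k].
  by apply/imsetP => -[u _ kE]; have := kp u; rewrite kE eqxx.
have sumT (G : K -> bool) : \big[addb/false]_(j in T) G j =
    G k (+) \xor_(u | predT u) (M u k && G (p u)).
  rewrite big_setU1 //= big_imset /=; last by move=> ? ? _ _; apply: pI.
  congr (_ (+) _); rewrite big_mkcond; apply: eq_bigr => u _.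
  by rewrite !inE; case: (M u k).
have kerT : kernel_set T.
  move=> v; rewrite sumT; under eq_bigr do rewrite Mp andbC eq_sym.
  by rewrite xor_at addbb.
by have := rF T kerT; rewrite sumT; case: (F k); case: (\xor_(_ | _) _).
Qed.

Lemma labelled_zero_sum m n (B : 'M['F_2]_(m, n)) r t (T : {set K}) :
  labelled B r t -> zero_sum B (t @: T) <-> kernel_set T.
Proof.
move=> [[r' rK r'K] [t' tK _] BE]; have tI := can_inj tK.
have colE u : ((\sum_(j in t @: T) col j B)%R (r u) ord0 =
    (\big[addb/false]_(k in T) M u k)%:R)%R.
  rewrite summxE big_imset /=; last by move=> ? ? _ _; apply: tI.
  by rewrite F2_natr_xor; apply: eq_bigr => k _; rewrite mxE BE.
split=> [/eqP zT u|kerT].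
  have := colE u; rewrite zT mxE.
  by case: (\big[_/_]_(_ in _) _) => // /eqP; rewrite eq_sym oner_eq0.
apply/eqP/matrixP => i j; rewrite (ord1 j) -(r'K i) colE kerT.
by rewrite mxE.
Qed.

End LabelledMatrix.

Section LabelledIso.
Variables (V K V' K' : finType).
Variables (M : V -> K -> bool) (M' : V' -> K' -> bool).
Variables (p : V -> K) (p' : V' -> K').
Hypotheses (Mp : forall u v, M u (p v) = (u == v)).
Hypotheses (Mp' : forall u v, M' u (p' v) = (u == v)).
Variables (m n m' n' : nat) (B : 'M['F_2]_(m, n)) (B' : 'M['F_2]_(m', n')).
Variables (r : V -> 'I_m) (t : K -> 'I_n) (r' : V' -> 'I_m') (t' : K' -> 'I_n').
Hypotheses (LB : labelled M B r t) (LB' : labelled M' B' r' t').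

Lemma matroid_iso_rows : matroid_iso (binary_matroid B) (binary_matroid B') ->
  exists th : K -> K', exists ht : K' -> K,
  [/\ cancel th ht, cancel ht th &
    forall F, (forall k, F k = \xor_(u | predT u) (M' u k && F (p' u))) <->
      (forall k, F (th k) = \xor_(u | predT u) (M u k && F (th (p u))))].
Proof.
have [_ [tv tK tvK] _] := LB; have [_ [tv' tK' tvK'] _] := LB'.
case=> f [g fK gK] fdep.
exists (tv' \o (f \o t)), (tv \o (g \o t')).
have thK : cancel (tv' \o (f \o t)) (tv \o (g \o t')).
  by move=> k; rewrite /= tvK' fK tK.
have htK : cancel (tv \o (g \o t')) (tv' \o (f \o t)).
  by move=> k; rewrite /= tvK gK tK'.
set th := _ \o _ in thK htK *; set ht := _ \o _ in thK htK *.
split=> // F; rewrite -(row_functionP Mp').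
have := row_functionP Mp (F \o th) => /= <-.
have fzero := matroid_iso_zero_sum (Bijective fK gK) fdep.
have gdep (S : {set 'I_n'}) : @dependent (binary_matroid B) (g @: S) =
    @dependent (binary_matroid B') S.
  by rewrite -fdep -imset_comp (eq_imset (g := id)) ?imset_id.
have gzero := matroid_iso_zero_sum (Bijective gK fK) gdep.
have ker T : kernel_set M T -> kernel_set M' (th @: T).
  move/(labelled_zero_sum _ LB)/fzero => zT; apply/(labelled_zero_sum _ LB').
  congr (is_true (zero_sum B' _)): zT.
  by rewrite -!imset_comp; apply: eq_imset => k; rewrite /= tvK'.
have ker' T : kernel_set M' T -> kernel_set M (ht @: T).
  move/(labelled_zero_sum _ LB')/gzero => zT; apply/(labelled_zero_sum _ LB).
  congr (is_true (zero_sum B _)): zT.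
  by rewrite -!imset_comp; apply: eq_imset => k; rewrite /= tvK.
split=> rF T kerT.
  have := rF _ (ker _ kerT); rewrite big_imset //= => ? ? _ _.
  exact: (can_inj thK).
have := rF _ (ker' _ kerT); rewrite big_imset /=; last first.
  by move=> ? ? _ _; apply: (can_inj htK).
by apply: etrans; apply: eq_bigr => k _; rewrite /= htK.
Qed.

Lemma labelled_matroid_iso (f : V -> V') (g : K -> K') :
  bijective f -> bijective g -> (forall u k, M' (f u) (g k) = M u k) ->
  matroid_iso (binary_matroid B) (binary_matroid B').
Proof.
move=> [f' fK f'K] [g' gK g'K] fgM.
have [_ [tv tK tvK] _] := LB; have [_ [tv' tK' tvK'] _] := LB'.
have phiK : cancel (t' \o (g \o tv)) (t \o (g' \o tv')).
  by move=> k; rewrite /= tK' gK tvK.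
have phiK' : cancel (t \o (g' \o tv')) (t' \o (g \o tv)).
  by move=> k; rewrite /= tK g'K tvK'.
set phi := t' \o _ in phiK phiK'.
have zero (T : {set 'I_n}) : zero_sum B' (phi @: T) = zero_sum B T.
  have -> : T = t @: (tv @: T).
    by rewrite -imset_comp (eq_imset (g := id)) ?imset_id.
  have -> : phi @: (t @: (tv @: T)) = t' @: (g @: (tv @: T)).
    by rewrite -!imset_comp; apply: eq_imset => k; rewrite /phi /= tK.
  apply/idP/idP => [/(labelled_zero_sum _ LB') kerT|/(labelled_zero_sum _ LB) kerT].
    apply/(labelled_zero_sum _ LB) => u; have := kerT (f u).
    rewrite big_imset /=; last by move=> ? ? _ _; apply: (can_inj gK).
    by apply: etrans; apply: eq_bigr => k _; rewrite fgM.
  apply/(labelled_zero_sum _ LB') => u.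
  rewrite big_imset /=; last by move=> ? ? _ _; apply: (can_inj gK).
  apply: etrans (kerT (f' u)); apply: eq_bigr => k _.
  by rewrite -[in LHS](f'K u) fgM.
exists phi; first by exists (t \o (g' \o tv')).
move=> S; apply/dependentP/dependentP => -[T [TS T0 zT]].
  have TE : phi @: ((t \o (g' \o tv')) @: T) = T.
    by rewrite -imset_comp (eq_imset (g := id)) ?imset_id.
  exists ((t \o (g' \o tv')) @: T); split.
  - apply/subsetP => j /imsetP[i iT ->]; have /imsetP[l lS ->] := subsetP TS i iT.
    by rewrite phiK.
  - by apply: contraNneq T0 => E; rewrite -TE E imset0.
  - by rewrite -zero TE.
exists (phi @: T); split; first exact: imsetS.
  by rewrite -card_gt0 card_imset ?card_gt0 //; apply: (can_inj phiK).
by rewrite zero.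
Qed.

End LabelledIso.

(** * The isotropic matroids of a forest *)

Section Labels.
Variable G : sgraph.

Definition IA_entry (u : G) (z : G * bool) :=
  if z.2 then adj z.1 u else u == z.1.

Definition IA_label (z : G * bool) : 'I_(#|G| + #|G|) :=
  if z.2 then rshift _ (enum_rank z.1) else lshift _ (enum_rank z.1).

Definition IAS_label (z : G * option bool) : 'I_(#|G| + #|G| + #|G|) :=
  match z.2 with
  | Phi => lshift _ (lshift _ (enum_rank z.1))
  | Chi => lshift _ (rshift _ (enum_rank z.1))
  | Psi => rshift _ (enum_rank z.1)
  end.

Lemma IA_labelled : labelled IA_entry (IA G) (@enum_rank G) IA_label.
Proof.
split=> [||u [v k]]; first exact: enum_rank_bij.
  apply: inj_card_bij; last by rewrite card_ord card_prod card_bool muln2 addnn.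
  move=> [u [] ] [v []] /eqP; rewrite /IA_label /= ?eq_lrshift ?eq_rlshift //.
    by rewrite eq_rshift => /eqP/enum_rank_inj ->.
  by rewrite eq_lshift => /eqP/enum_rank_inj ->.
rewrite /IA /IA_label /IA_entry; case: k => /=.
  by rewrite row_mxEr mxE !enum_rankK adj_sym.
by rewrite row_mxEl mxE (inj_eq enum_rank_inj).
Qed.

Lemma IAS_labelled :
  labelled (fun u => unit_row (@adj G) u) (IAS G) (@enum_rank G) IAS_label.
Proof.
split=> [||u [v k]]; first exact: enum_rank_bij.
  apply: inj_card_bij; last first.
    by rewrite card_ord card_prod card_option card_bool !mulnS muln0 addn0 addnA.
  move=> [u k] [v j] /eqP; rewrite /IAS_label /=.
  case: k j => [[]|] [[]|]; rewrite ?eq_lrshift ?eq_rlshift ?eq_lshift ?eq_rshift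
    ?eq_lrshift ?eq_rlshift //.
  - by move/eqP/enum_rank_inj->.
  - by move/eqP/enum_rank_inj->.
  - by move/eqP/enum_rank_inj->.
rewrite /IAS /IAS_label /unit_row; case: k => [[]|] /=.
- by rewrite row_mxEl row_mxEr mxE !enum_rankK adj_sym.
- rewrite row_mxEr !mxE !enum_rankK (inj_eq enum_rank_inj) (adj_sym v).
  by rewrite (eq_sym v) F2_natr_addb.
- by rewrite !row_mxEl mxE (inj_eq enum_rank_inj) eq_sym.
Qed.

Lemma forest_relP : is_forest G -> forest_rel (@adj G).
Proof.
move=> hG; split; [exact: adj_sym|exact: adj_irrefl|].
exact: acyclic_one_degenerate (@adj_sym G) (@adj_irrefl G) hG.
Qed.

Lemma IAS_rowsP F : iso_rows (@adj G) F <->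
  forall z, F z = \xor_(u | predT u) (unit_row (@adj G) u z && F (u, Phi)).
Proof.
have xor_at v (H : G -> bool) : \xor_(u | predT u) ((v == u) && H u) = H v.
  by rewrite (bigD1 v) //= eqxx /= big1 ?addbF // => u; rewrite eq_sym; case: eqP.
have chiE v : \xor_(u | predT u) (unit_row (@adj G) u (v, Chi) && F (u, Phi)) =
    \xor_(u | adj v u) F (u, Phi).
  by rewrite [RHS]big_mkcond; apply: eq_bigr => u _; rewrite /unit_row /=; case: adj.
have psiE v : \xor_(u | predT u) (unit_row (@adj G) u (v, Psi) && F (u, Phi)) =
    F (v, Phi) (+) \xor_(u | adj v u) F (u, Phi).
  rewrite -chiE -(xor_at v (fun u => F (u, Phi))) -big_split /=.
  by apply: eq_bigr => u _; rewrite /unit_row /= andb_addl.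
split=> [rF [v k]|rF v].
  have [Fc Fp] := rF v; case: k => [[]|]; first by rewrite chiE.
    by rewrite psiE Fp Fc.
  by rewrite xor_at.
by rewrite (rF (v, Psi)) psiE (rF (v, Chi)) chiE.
Qed.

(** The identity block is a basis, and its fundamental graph joins [(v, true)] to [(u, false)] for
    adjacent [u] and [v], which is the double cover. *)
Lemma IA_rowsP F : row_space [set z | ~~ z.2] (double_cover (@adj G)) F <->
  forall z, F z = \xor_(u | predT u) (IA_entry u z && F (u, false)).
Proof.
have xor_at v (H : G -> bool) : \xor_(u | predT u) ((u == v) && H u) = H v.
  by rewrite (bigD1 v) //= eqxx /= big1 ?addbF // => u; case: eqP.
have sumE v : \xor_(z | double_cover (@adj G) (v, true) z) F z =
    \xor_(u | predT u) (IA_entry u (v, true) && F (u, false)).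
  rewrite (reindex_onto (fun u => (u, false)) fst) /=; last by case=> u [].
  rewrite big_mkcond; apply: eq_bigr => u _.
  by rewrite /IA_entry /double_cover /= eqxx andbT; case: adj.
split=> [rF [v []]|rF [v []]]; rewrite ?inE //.
- by rewrite rF ?inE.
- by rewrite xor_at.
- by move=> _; rewrite rF sumE.
Qed.

End Labels.

Lemma IA_entry_basis (G : sgraph) (u v : G) : IA_entry u (v, false) = (u == v).
Proof. by []. Qed.

Lemma unit_row_basis (G : sgraph) (u v : G) :
  unit_row (@adj G) u (v, Phi) = (u == v).
Proof. exact: eq_sym. Qed.

Lemma graph_iso_restricted (F F' : sgraph) : graph_iso F F' ->
  matroid_iso (restricted_isotropic_matroid F) (restricted_isotropic_matroid F').
Proof.
case=> f [f' fK f'K] fadj.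
apply: (labelled_matroid_iso (IA_labelled F) (IA_labelled F')
  (f := f) (g := fun z => (f z.1, z.2))); first by exists f'.
  by exists (fun z => (f' z.1, z.2)) => -[v k] /=; rewrite ?fK ?f'K.
by move=> u [v k]; rewrite /IA_entry /= fadj (inj_eq (can_inj fK)).
Qed.

Lemma graph_iso_isotropic (F F' : sgraph) : graph_iso F F' ->
  matroid_iso (isotropic_matroid F) (isotropic_matroid F').
Proof.
case=> f [f' fK f'K] fadj.
apply: (labelled_matroid_iso (IAS_labelled F) (IAS_labelled F')
  (f := f) (g := fun z => (f z.1, z.2))); first by exists f'.
  by exists (fun z => (f' z.1, z.2)) => -[v k] /=; rewrite ?fK ?f'K.
by move=> u [v k]; rewrite /unit_row /= fadj (inj_eq (can_inj fK)).
Qed.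

Lemma isotropic_graph_iso (F F' : sgraph) : is_forest F -> is_forest F' ->
  matroid_iso (isotropic_matroid F) (isotropic_matroid F') -> graph_iso F F'.
Proof.
move=> hF hF' iso.
have [th [ht [thK htK rows]]] := matroid_iso_rows (@unit_row_basis F)
  (@unit_row_basis F') (IAS_labelled F) (IAS_labelled F') iso.
have gd : marked_row_iso (@adj F) (@adj F') xpred0 th ht.
  split=> //; split=> // R; rewrite IAS_rowsP rows.
  exact: (iff_sym (IAS_rowsP (R \o th))).
have [g gbij [_ gE]] :=
  isotropic_rows_unique (forest_relP hF) (forest_relP hF') gd.
by exists g.
Qed.

Lemma double_cover_fundamental (G : sgraph) : is_forest G ->
  fundamental_graph [set z : G * bool | ~~ z.2] (double_cover (@adj G)).
Proof.
move=> hG; have [a_sym a_irr a_deg] := forest_relP hG; split.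
- by move=> p q; rewrite /double_cover /= eq_sym a_sym.
- by move=> p; rewrite /double_cover /= eqxx.
- have [col colP] := one_degenerate_colouring a_sym a_irr a_deg.
  move=> S /set0Pn[[v i] vS].
  (* [T] is the projection of the part of [S] where colour plus sheet has the same value as at
     [(v, i)]; edges of the cover never leave such a part. *)
  pose T := [set u | (u, col u (+) (col v (+) i)) \in S].
  have [|u uT uniqu] := a_deg T.
    by apply/set0Pn; exists v; rewrite inE addKb.
  exists (u, col u (+) (col v (+) i)); first by move: uT; rewrite inE.
  have inT z j : (z, j) \in S -> double_cover (@adj G) (u, col u (+) (col v (+) i)) (z, j) ->
      [/\ z \in T, adj u z & j = col z (+) (col v (+) i)].
    rewrite /double_cover /= => zS /andP[uj auz]; have jE : j = col z (+) (col v (+) i).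
      have := colP _ _ auz; move: uj.
      by case: j {zS}; case: (col u); case: (col z); case: (col v (+) i).
    by split=> //; rewrite inE -jE.
  move=> [y j] [z k] yS zS /(inT _ _ yS)[yT uy ->] /(inT _ _ zS)[zT uz ->].
  by rewrite (uniqu y z).
- by move=> [u i] [v j] /andP[/= ij _]; rewrite !inE /=; move: ij; case: i; case: j.
Qed.

(** The cover of [F'] is pulled back along [th], so that two forests on one ground set present the
    same row space; the resulting isomorphism of covers is then cancelled. *)
Lemma restricted_graph_iso (F F' : sgraph) : is_forest F -> is_forest F' ->
  matroid_iso (restricted_isotropic_matroid F) (restricted_isotropic_matroid F') ->
  graph_iso F F'.
Proof.
move=> hF hF' iso.
have [th [ht [thK htK rows]]] := matroid_iso_rows (@IA_entry_basis F)
  (@IA_entry_basis F') (IA_labelled F) (IA_labelled F') iso.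
pose dc := double_cover (@adj F); pose dc' := double_cover (@adj F').
pose B2 := [set z | ~~ (th z).2]; pose e2 := [rel a b | dc' (th a) (th b)].
have [dsym dirr ddeg dbip] := double_cover_fundamental hF'.
have fg2 : fundamental_graph B2 e2.
  split=> [a b|a|S S0|a b]; rewrite ?inE.
  - exact: dsym.
  - exact: dirr.
  - have [|y] := ddeg (th @: S).
      by rewrite -card_gt0 card_imset ?card_gt0 //; apply: (can_inj thK).
    case/imsetP=> z zS -> uniqz; exists z => // a b aS bS /uniqz ua /ua ub.
    by apply: (can_inj thK); apply: ub; apply: imset_f.
  - by move=> /dbip; rewrite !inE.
have same : same_rows [set z : F * bool | ~~ z.2] dc B2 e2.
  move=> f.
  have -> : row_space B2 e2 f <->
      row_space [set z : F' * bool | ~~ z.2] dc' (f \o ht).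
    have sumE y : \xor_(z | dc' (th y) z) f (ht z) = \xor_(z | e2 y z) f z.
      rewrite (reindex th) /=; last by exists ht => z _.
      by apply: eq_bigr => z _; rewrite thK.
    split=> rf y yB.
      have := rf (ht y); rewrite inE htK -sumE htK; apply.
      by move: yB; rewrite inE.
    have := rf (th y); rewrite /= thK sumE; apply.
    by move: yB; rewrite !inE.
  rewrite !IA_rowsP rows /=.
  split=> rf z; first by rewrite thK rf; apply: eq_bigr => u _; rewrite thK.
  by have := rf z; rewrite thK => ->; apply: eq_bigr => u _; rewrite thK.
have [|g gI [_ gE]] := fundamental_graph_unique (C := set0)
  (double_cover_fundamental hF) fg2 same; first by move=> z; rewrite in_set0.
have [sF iF dF] := forest_relP hF; have [sF' iF' dF'] := forest_relP hF'.
have [col colP] := one_degenerate_colouring sF iF dF.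
have [col' colP'] := one_degenerate_colouring sF' iF' dF'.
apply: (double_cover_cancel (g := th \o g) sF colP colP') => [|p q].
  apply: bij_comp (injF_bij gI); first by exists ht.
exact: gE.
Qed.

Theorem theorem3 (F F' : sgraph) (hF : is_forest F) (hF' : is_forest F') :
  [<-> graph_iso F F';
       matroid_iso (restricted_isotropic_matroid F)
                   (restricted_isotropic_matroid F');
       matroid_iso (isotropic_matroid F) (isotropic_matroid F')].
Proof.
tfae.
- exact: graph_iso_restricted.
- by move/(restricted_graph_iso hF hF'); apply: graph_iso_isotropic.
- exact: isotropic_graph_iso.
Qed.
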